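(* Let $p\in(0,+\infty)$. Then the set $$\{f\in H^p:\ \text{for every } q \text{ with } p<q<+\infty \text{ and all real } a<b,\ f\notin H^q_{[a,b]}(D)\}$$ $$=\Big\{f\in H^p:\ \text{for all } q \text{ with } p<q<+\infty \text{ and all real } a<b,\ \sup_{0<r<1}\int_a^b|f(re^{i\theta})|^q\,d\theta=+\infty\Big\}$$ is a $G_\delta$ and dense subset of $H^p$. In particular it is non-empty.
   Context: $D=\{z\in\mathbb{C}:|z|<1\}$. For $0<p<\infty$, $H^p=H^p(D)$ is the Hardy space of holomorphic functions $f$ on $D$ with $\sup_{0<r<1}\int_0^{2\pi}|f(re^{i\theta})|^p\,d\theta<+\infty$, with its usual complete metrizable vector space topology: $f_n\to f$ in $H^p$ iff $\sup_{0<r<1}\int_0^{2\pi}|f_n(re^{i\theta})-f(re^{i\theta})|^p\,d\theta\to0$. For real $a<b$ and $0<q<\infty$, the localized Hardy space $H^q_{[a,b]}(D)$ is the set of holomorphic functions $f$ on $D$ with $\sup_{0<r<1}\int_a^b|f(re^{i\theta})|^q\,d\theta<+\infty$. *)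

(* Defs.v *)
From HB Require Import structures.
From mathcomp Require Import all_boot all_order all_algebra.
From mathcomp Require Import all_classical all_reals all_analysis.
From mathcomp Require Export complex.

Set Implicit Arguments.
Unset Strict Implicit.
Unset Printing Implicit Defensive.

Import Order.TTheory GRing.Theory Num.Theory.
Import numFieldNormedType.Exports.
Import Normc.

Local Open Scope classical_set_scope.
Local Open Scope ring_scope.
Local Open Scope complex_scope.

Section hardy.
Context {R : realType}.
Implicit Types (f g : R[i] -> R[i]) (p q a b r t : R).

Definition unit_disc : set R[i] := [set z | normc z < 1].

(* A function on the disc is encoded by its extension by zero to the whole    *)
(* plane, so that equality in R[i] -> R[i] is equality on the disc. The       *)
(* scalars of R[i]^o are R[i], so `derivable` is complex differentiability.   *)
Definition holomorphic_disc : set (R[i] -> R[i]) :=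
  [set f | (forall z, unit_disc z ->
              derivable (f : R[i]^o -> R[i]^o) (z : R[i]^o) (1 : R[i]^o)) /\
           (forall z, ~ unit_disc z -> f z = 0)].

Definition polar r t : R[i] := (r * cos t) +i* (r * sin t).

Definition sup_mean (p a b : R) f : \bar R :=
  ereal_sup [set (\int[lebesgue_measure]_(t in `[a, b])
                     (normc (f (polar r t)) `^ p)%:E)%E | r in `]0, 1[].

Definition hardy_space (p : R) : set (R[i] -> R[i]) :=
  [set f | holomorphic_disc f /\ (sup_mean p 0 (2 * pi) f < +oo)%E].

Definition local_hardy_space (q a b : R) : set (R[i] -> R[i]) :=
  [set f | holomorphic_disc f /\ (sup_mean q a b f < +oo)%E].

Definition hardy_gap (p : R) f g : \bar R :=
  sup_mean p 0 (2 * pi) (fun z => f z - g z).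

End hardy.

Record hardy (R : realType) (p : R) := Hardy {
  hardy_fun :> R[i] -> R[i] ;
  _ : hardy_fun \in hardy_space p }.

HB.instance Definition _ (R : realType) (p : R) :=
  [isSub for @hardy_fun R p].
HB.instance Definition _ (R : realType) (p : R) :=
  [Choice of hardy p by <:].

Section hardy_topology.
Context {R : realType} (p : R).

(* The gap is a distance for 0 < p <= 1 and its p-th root is one for p >= 1.  *)
(* The sets {g | gap g f < e} are the balls of that distance centred at f, so *)
(* this is its metric topology, in which f_n tends to f iff gap f_n f tends   *)
(* to 0.                                                                      *)
Definition hardy_open : set_system (hardy p) :=
  [set U | forall f : hardy p, U f -> exists2 e : R, 0 < e &
     forall g : hardy p, (hardy_gap p g f < e%:E)%E -> U g].

Let hardy_openT : hardy_open setT.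
Proof. by move=> f _; exists 1. Qed.

Let hardy_openI : setI_closed hardy_open.
Proof.
move=> U V oU oV f [/oU[d d0 dU] /oV[e e0 eV]].
exists (Num.min d e); first by rewrite lt_min d0.
by move=> g gfe; split; [apply: dU|apply: eV];
  apply: (lt_le_trans gfe); rewrite lee_fin ge_min lexx ?orbT.
Qed.

Let hardy_open_bigU (I : Type) (F : I -> set (hardy p)) :
  (forall i, hardy_open (F i)) -> hardy_open (\bigcup_i F i).
Proof.
move=> oF f [i _ /oF[e e0 eF]]; exists e => // g gfe.
by exists i => //; exact: eF.
Qed.

HB.instance Definition _ := isOpenTopological.Build (hardy p)
  hardy_openT hardy_openI hardy_open_bigU.

End hardy_topology.

(* Main.v *)
Require Import Defs.
From mathcomp Require Import all_boot all_order all_algebra.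
From mathcomp Require Import all_classical all_reals all_analysis.
From mathcomp Require Import borel_hierarchy.
From mathcomp Require Import measurable_realfun ring lra complex.

(* Openness of { sup_mean q a b > M } needs no complex analysis: the integral
   of |f|^q over an arc of a fixed circle is lower semicontinuous for the L^p
   distance on that circle, because f is bounded there. Intersecting over
   countably many exponents q and rational arcs gives the G_delta part.

   For density, let h in H^p lie in no H^q_[a,b] with q > p. For each exponent
   and each rational arc, f + c h is in the local space for at most one c, so
   all but countably many c work, and small c keep f + c h close to f.

   For h, take P = n p >= 2 and h = H^n, where H is a sum of Cauchy kernels
   a_k / (1 - conj(w_k) z), with w_k tending very fast to the circle along
   directions which repeat every rational angle infinitely often. Each kernel
   has nonnegative real part, so terms cannot cancel and |H| is at least the
   real part of each term; near its direction a term has large q-mean for every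
   q > P. The P-th power of a term is dominated by a Poisson kernel, hence
   H is in H^P. *)

Set Implicit Arguments.
Unset Strict Implicit.
Unset Printing Implicit Defensive.

Import Order.TTheory GRing.Theory Num.Theory.
Import numFieldNormedType.Exports.
Import Normc.

Local Open Scope classical_set_scope.
Local Open Scope ring_scope.
Local Open Scope complex_scope.
Local Notation Re := complex.Re.
Local Notation Im := complex.Im.

(** * Integrals over segments *)

Section lebesgue_translation.
Context {R : realType}.
Local Notation mu := (@lebesgue_measure R).
Local Notation translation c :=
  ((fun x : R => x + c) : measurableTypeR R -> measurableTypeR R).

Lemma measurable_translation (c : R) :
  measurable_fun setT (translation c).
Proof. exact: measurable_funD. Qed.

(** Both measures agree on half-open intervals, and Lebesgue measure is determined by its values
    there. *)
Lemma lebesgue_measure_translation (c : R) (A : set R) : measurable A ->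
  pushforward mu (translation c) A = mu A.
Proof.
move=> mA; apply/esym/lebesgue_measure_unique => //=.
  exact: measurable_translation.
move=> mphi _ [[a b]] _ <-.
rewrite /pushforward.
have -> : (fun x => x + c) @^-1` [set` `]a, b]] = [set` `]a - c, b - c]].
  by apply/seteqP; split=> x /=; rewrite !in_itv/= ltrBlDr lerBrDr.
rewrite !lebesgue_measure_itv/= !lte_fin ltrD2r.
by rewrite -!EFinB; congr (if _ then _%:E else _); ring.
Qed.

Lemma ge0_integral_translation (F : R -> R) (a b c : R) :
  measurable_fun setT F -> (forall t, 0 <= F t) ->
  (\int[mu]_(t in `[(a + c)%R, (b + c)%R]) (F t)%:E =
   \int[mu]_(t in `[a, b]) (F (t + c)%R)%:E)%E.
Proof.
move=> mF F0.
have -> : `[a, b]%classic = translation c @^-1` `[a + c, b + c]%classic.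
  by apply/seteqP; split=> x /=; rewrite !in_itv/= !lerD2r.
rewrite -(@ge0_integral_pushforward _ _ _ _ _ _ (measurable_translation c) _
  `[a + c, b + c]%classic (EFin \o F))//=.
- apply: eq_measure_integral => //=.
    exact: measurable_translation.
  by move=> mphi A mA AS; apply/esym; exact: lebesgue_measure_translation.
- by apply/measurable_EFinP; exact: measurable_funS mF.
- by move=> y _; rewrite lee_fin.
Qed.

End lebesgue_translation.

(** * Integrals over a segment: order, linearity, periodicity *)

Section segment_integral.
Context {R : realType}.
Local Notation mu := (@lebesgue_measure R).
Implicit Types (F G : R -> R) (a b c : R).

Definition seg_int a b F : \bar R := (\int[mu]_(t in `[a, b]) (F t)%:E)%E.

Lemma seg_int_ge0 a b F : (forall t, 0 <= F t) -> (0 <= seg_int a b F)%E.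
Proof. by move=> F0; apply: integral_ge0 => t _; rewrite lee_fin. Qed.

Lemma le_seg_int a b F G :
  measurable_fun setT F -> measurable_fun setT G ->
  (forall t, 0 <= F t) -> (forall t, a <= t <= b -> F t <= G t) ->
  (seg_int a b F <= seg_int a b G)%E.
Proof.
move=> mF mG F0 FG; apply: ge0_le_integral => //.
- by move=> t _; rewrite lee_fin.
- by apply/measurable_EFinP; exact: measurable_funS mF.
- by apply/measurable_EFinP; exact: measurable_funS mG.
Qed.

Lemma seg_intD a b F G :
  measurable_fun setT F -> measurable_fun setT G ->
  (forall t, 0 <= F t) -> (forall t, 0 <= G t) ->
  seg_int a b (fun t => F t + G t) = (seg_int a b F + seg_int a b G)%E.
Proof.
move=> mF mG F0 G0; rewrite /seg_int -ge0_integralD//.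
- by move=> t _; rewrite lee_fin.
- by apply/measurable_EFinP; exact: measurable_funS mF.
- by move=> t _; rewrite lee_fin.
- by apply/measurable_EFinP; exact: measurable_funS mG.
Qed.

Lemma seg_intZ a b (k : R) F :
  measurable_fun setT F -> (forall t, 0 <= F t) -> 0 <= k ->
  seg_int a b (fun t => k * F t) = (k%:E * seg_int a b F)%E.
Proof.
move=> mF F0 k0; rewrite /seg_int -ge0_integralZl_EFin//.
- by move=> t _; rewrite lee_fin.
- by apply/measurable_EFinP; exact: measurable_funS mF.
Qed.

Lemma seg_int_cst a b (k : R) : a <= b ->
  seg_int a b (fun=> k) = (k * (b - a))%:E.
Proof.
move=> ab; rewrite /seg_int integral_cst//= lebesgue_measure_itv/= lte_fin.
by case: ltgtP ab => // -> _; rewrite subrr mulr0 mule0.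
Qed.

Lemma seg_int_sub a b a' b' F :
  measurable_fun setT F -> (forall t, 0 <= F t) -> a' <= a -> b <= b' ->
  (seg_int a b F <= seg_int a' b' F)%E.
Proof.
move=> mF F0 aa bb; apply: ge0_subset_integral => //.
- by apply/measurable_EFinP; exact: measurable_funS mF.
- by move=> t _; rewrite lee_fin.
- by apply: subset_itv; rewrite bnd_simp.
Qed.

Lemma seg_int_split a b c F :
  measurable_fun setT F -> (forall t, 0 <= F t) -> a <= b -> b <= c ->
  (seg_int a c F <= seg_int a b F + seg_int b c F)%E.
Proof.
move=> mF F0 ab bc.
rewrite {1}/seg_int (@itv_bndbnd_setU _ _ (BLeft a) (BRight b))//.
rewrite ge0_integral_setU//=.
- apply: leeD => //; apply: ge0_subset_integral => //.
  + by apply/measurable_EFinP; exact: measurable_funS mF.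
  + by move=> t _; rewrite lee_fin.
  + exact: subset_itv_oc_cc.
- by apply/measurable_EFinP; exact: measurable_funS mF.
- by move=> t _; rewrite lee_fin.
- apply/disj_setPS => t [] /=; rewrite !in_itv/= => /andP[_ tb] /andP[bt _].
  by move: (lt_le_trans bt tb); rewrite ltxx.
Qed.

(** Bounds the integral over an arbitrary arc, possibly longer than a full turn, by that over one
    period, with a factor independent of the function. The arc lies in [[-nT, nT]], which consists
    of [2n] periods. *)
Lemma seg_int_periodic_cover (T : R) a b : 0 < T ->
  exists2 K : R, 0 < K & forall F, measurable_fun setT F ->
    (forall t, 0 <= F t) -> (forall t, F (t + T) = F t) ->
    (seg_int a b F <= K%:E * seg_int 0 T F)%E.
Proof.
move=> T0.
pose n := (Num.truncn ((`|a| + `|b|) / T)).+1.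
have nT : `|a| + `|b| <= n%:R * T.
  rewrite -ler_pdivrMr//; apply/ltW/truncnS_gt.
exists (2 * n)%:R; first by rewrite ltr0n muln_gt0.
move=> F mF F0 perF.
have perFn m t : F (t + m%:R * T) = F t.
  elim: m t => [|m IH] t; first by rewrite mul0r addr0.
  by rewrite -natr1 mulrDl mul1r addrA perF IH.
have shift m c d : seg_int (c + m%:R * T) (d + m%:R * T) F = seg_int c d F.
  rewrite /seg_int ge0_integral_translation//.
  by apply: eq_integral => t _; rewrite perFn.
apply: (@le_trans _ _ (seg_int (- (n%:R * T)) (n%:R * T) F)).
  apply: seg_int_sub => //.
    rewrite lerNl; apply: le_trans nT; rewrite -[leLHS]addr0.
    by apply: lerD => //; rewrite -normrN ler_norm.
  apply: le_trans nT; rewrite -[leLHS]add0r.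
  by apply: lerD => //; rewrite ler_norm.
elim: n {nT} => [|n IH].
  rewrite mul0r oppr0 muln0 mul0e /seg_int set_itv1 integral_set1//.
have nT0 : 0 <= n%:R * T by rewrite mulr_ge0// ltW.
have nT1 : n.+1%:R * T = n%:R * T + T by rewrite -natr1 mulrDl mul1r.
apply: (@le_trans _ _ (seg_int (- (n.+1%:R * T)) (- (n%:R * T)) F +
  (seg_int (- (n%:R * T)) (n%:R * T) F +
   seg_int (n%:R * T) (n.+1%:R * T) F))%E).
  apply: (le_trans (@seg_int_split _ (- (n%:R * T)) _ F mF F0 _ _)).
  - by rewrite nT1; lra.
  - by rewrite nT1; lra.
  by apply: leeD => //; apply: seg_int_split => //; lra.
have -> : seg_int (- (n.+1%:R * T)) (- (n%:R * T)) F = seg_int 0 T F.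
  by rewrite -(shift n.+1 (- (n.+1%:R * T))) addNr nT1 addKr.
have -> : seg_int (n%:R * T) (n.+1%:R * T) F = seg_int 0 T F.
  by rewrite nT1 -(shift n 0 T) add0r addrC.
have -> : (2 * n.+1)%:R = 1 + (2 * n)%:R + 1 :> R.
  by rewrite mulnS natrD; ring.
rewrite !EFinD !ge0_muleDl ?adde_ge0 ?lee_fin//.
rewrite mul1e -(addeA (seg_int 0 T F) (_ * _)%E).
by apply: leeD => //; exact: leeD.
Qed.

End segment_integral.

(** * Holomorphic functions on circles *)

Section complex_modulus.
Context {R : realType}.
Implicit Types (z w : R[i]).

Lemma normrE z : `|z| = (normc z)%:C.
Proof. by []. Qed.

Lemma normc_ge0 z : 0 <= normc z.
Proof. by case: z => x y /=; rewrite sqrtr_ge0. Qed.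

Lemma normcX z n : normc (z ^+ n) = normc z ^+ n.
Proof. by elim: n => [|n IH]; rewrite ?expr0 ?normc1// !exprS normcM IH. Qed.

Lemma normcB z w : normc (z - w) = normc (w - z).
Proof. by rewrite -opprB normcN. Qed.

Lemma normc_real (x : R) : normc x%:C = `|x|.
Proof. by rewrite /= expr0n/= addr0 sqrtr_sqr. Qed.

Lemma sqr_normcE z : normc z ^+ 2 = Re z ^+ 2 + Im z ^+ 2.
Proof. by case: z => x y /=; rewrite sqr_sqrtr ?addr_ge0 ?sqr_ge0. Qed.

Lemma normr_Re_le z : `|Re z| <= normc z.
Proof.
rewrite -(@ler_pXn2r _ 2)// ?nnegrE ?normc_ge0// sqr_normcE.
by rewrite real_normK ?num_real// lerDl sqr_ge0.
Qed.

Lemma normr_Im_le z : `|Im z| <= normc z.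
Proof.
rewrite -(@ler_pXn2r _ 2)// ?nnegrE ?normc_ge0// sqr_normcE.
by rewrite real_normK ?num_real// lerDr sqr_ge0.
Qed.

Lemma normc_le_ReIm z : normc z <= `|Re z| + `|Im z|.
Proof.
rewrite -(@ler_pXn2r _ 2)// ?nnegrE ?normc_ge0 ?addr_ge0// sqr_normcE.
rewrite sqrrD !real_normK ?num_real// -addrA lerD2l lerDr.
by rewrite mulrn_wge0// mulr_ge0.
Qed.

Lemma ler_distB_normc z w : `|normc z - normc w| <= normc (z - w).
Proof.
rewrite ler_norml; apply/andP; split.
  by rewrite lerNl opprB lerBlDr -[w in leLHS](subrK z) (normcB z) le_normcD.
by rewrite lerBlDr -[z in leLHS](subrK w) le_normcD.
Qed.

Lemma ReB z w : Re (z - w) = Re z - Re w.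
Proof. by case: z w => [a b] [c d]. Qed.

Lemma ImB z w : Im (z - w) = Im z - Im w.
Proof. by case: z w => [a b] [c d]. Qed.

(** Radii in the topology of [R[i]^o] are elements of [R[i]]; a positive one has zero imaginary
    part, so real radii suffice. *)
Lemma cvg_normcP (T : Type) (F : set_system T) (FF : Filter F)
    (u : T -> R[i]^o) (l : R[i]^o) :
  (u @ F --> l) <->
  (forall e : R, 0 < e -> \forall t \near F, normc (l - u t) < e).
Proof.
split.
  move=> /(@cvgrPdist_lt _ R[i]^o) ul e e0.
  have : (0 : R[i]) < e%:C by rewrite ltcR.
  move=> /ul; apply: filterS => t; by rewrite normrE ltcR.
move=> ul; apply/(@cvgrPdist_lt _ R[i]^o) => -[e e'] e0.
have /andP[/eqP e'0 {}e0] : (e' == 0) && (0 < e) by move: e0; rewrite ltcE/=.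
by near=> t; rewrite normrE e'0 ltcR; near: t; exact: ul.
Unshelve. all: by end_near. Qed.

Lemma continuous_polar (r : R) : continuous (polar r : R -> R[i]^o).
Proof.
move=> t; apply/cvg_normcP => e e0.
have r0 : 0 < 2 * (`|r| + 1) :> R by rewrite mulr_gt0// ltr_wpDl.
have d0 : 0 < e / (2 * (`|r| + 1)) by rewrite divr_gt0.
have /cvgrPdist_lt/(_ _ d0) c0 := @continuous_cos R t.
have /cvgrPdist_lt/(_ _ d0) s0 := @continuous_sin R t.
near=> s.
apply: (le_lt_trans (normc_le_ReIm _)).
rewrite ReB ImB /= -!mulrBr !normrM -mulrDr.
apply: (@le_lt_trans _ _ ((`|r| + 1) * (`|cos t - cos s| + `|sin t - sin s|))).
  by rewrite ler_wpM2r ?addr_ge0// lerDl.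
rewrite -ltr_pdivlMl; last by rewrite ltr_wpDl.
have -> : (`|r| + 1)^-1 * e = e / (2 * (`|r| + 1)) + e / (2 * (`|r| + 1)).
  by field; rewrite gt_eqF// ltr_wpDl.
by apply: ltrD; near: s.
Unshelve. all: by end_near. Qed.

Lemma normc_polar (r t : R) : normc (polar r t) = `|r|.
Proof.
apply/eqP; rewrite -(@eqrXn2 _ 2)// ?normc_ge0// sqr_normcE /= !exprMn -mulrDr.
by rewrite cos2Dsin2 mulr1 real_normK ?num_real.
Qed.

Lemma polar_disc (r t : R) : 0 < r < 1 -> unit_disc (polar r t).
Proof.
by move=> /andP[r0 r1]; rewrite /unit_disc /mkset normc_polar gtr0_norm.
Qed.

Lemma polarD2pi (r t : R) : polar r (t + 2 * pi) = polar r t.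
Proof. by rewrite /polar mulr_natl cosD2pi sinD2pi. Qed.

End complex_modulus.

(** * Stability of holomorphy, and a criterion for it *)

Section holomorphic.
Context {R : realType}.
Implicit Types (f g : R[i] -> R[i]).

Lemma holomorphic_circle_continuous f (r : R) : holomorphic_disc f -> 0 < r < 1 ->
  continuous (fun t => normc (f (polar r t))).
Proof.
move=> [df _] r01 t.
have /derivable1_diffP/differentiable_continuous cf := df _ (polar_disc t r01).
have : ((f \o polar r) s : R[i]^o) @[s --> t] --> (f (polar r t) : R[i]^o).
  exact: (cvg_comp _ _ (@continuous_polar R r t) cf).
move=> /cvg_normcP fp; apply/cvgrPdist_lt => e e0.
near=> s; apply: (le_lt_trans (ler_distB_normc _ _)).
by near: s; exact: fp.
Unshelve. all: by end_near. Qed.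

Lemma holomorphicD f g : holomorphic_disc f -> holomorphic_disc g ->
  holomorphic_disc (fun z => f z + g z).
Proof.
move=> [df f0] [dg g0]; split=> z zD; last by rewrite f0// g0// addr0.
exact: derivableD (df z zD) (dg z zD).
Qed.

Lemma holomorphicZ f (c : R[i]) : holomorphic_disc f ->
  holomorphic_disc (fun z => c * f z).
Proof.
move=> [df f0]; split=> z zD; last by rewrite f0// mulr0.
have := @derivableZ _ _ _ (f : R[i]^o -> R[i]^o) c _ _ (df z zD).
by congr derivable.
Qed.

Lemma holomorphicB f g : holomorphic_disc f -> holomorphic_disc g ->
  holomorphic_disc (fun z => f z - g z).
Proof.
move=> hf hg; have := holomorphicD hf (holomorphicZ (-1) hg).
by congr holomorphic_disc; apply/funext => z; rewrite mulN1r.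
Qed.

(** The exponent is [n.+1] because a zeroth power would equal 1 off the disc and break the extension
    by zero. *)
Lemma holomorphicX f n : holomorphic_disc f ->
  holomorphic_disc (fun z => f z ^+ n.+1).
Proof.
move=> [df f0]; split=> z zD; last by rewrite f0// exprS mul0r.
elim: n => [|n IH].
  have -> : (fun z => f z ^+ 1) = f by apply/funext => w; rewrite expr1.
  exact: df.
have -> : (fun z => f z ^+ n.+2) = (fun z => f z * f z ^+ n.+1).
  by apply/funext => w; rewrite exprS.
exact: (@derivableM _ _ (f : R[i]^o -> R[i]^o) _ _ _ (df z zD) IH).
Qed.

(** Dividing the quadratic error by [w] leaves at most [K |w|], so the difference quotient tends to
    [l]. *)
Lemma derivable_quadratic f (z l : R[i]) (d K : R) : 0 < d ->
  (forall w, normc w < d ->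
     normc (f (z + w) - f z - w * l) <= K * normc w ^+ 2) ->
  derivable (f : R[i]^o -> R[i]^o) (z : R[i]^o) (1 : R[i]^o).
Proof.
move=> d0 fl; apply/cvg_ex; exists l; apply/cvg_normcP => e e0.
have K0 : 0 < `|K| + 1 by rewrite ltr_wpDl.
have m0 : (0 : R[i]) < (Num.min d (e / (`|K| + 1)))%:C.
  by rewrite ltcR lt_min d0 divr_gt0.
exists (Num.min d (e / (`|K| + 1)))%:C => //= w.
rewrite /ball_ /mkset sub0r normrN normrE ltcR lt_min => /andP[wd we] w0.
have nw0 : 0 < normc w.
  rewrite lt_neqAle normc_ge0 andbT eq_sym.
  by apply: contra w0 => /eqP/eq0_normc ->.
have -> : l - w^-1 *: (f (w *: (1 : R[i]^o) + z) - f z) =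
    - (w^-1 * (f (z + w) - f z - w * l)).
  rewrite /GRing.scale/= mulr1 (addrC w z) !mulrBr mulrA mulVf// mul1r; ring.
rewrite normcN normcM normcV ltr_pdivrMl//.
apply: (le_lt_trans (fl _ wd)); rewrite expr2 mulrCA ltr_pM2l//.
apply: (@le_lt_trans _ _ ((`|K| + 1) * normc w)).
  by rewrite ler_wpM2r ?normc_ge0// (le_trans (ler_norm _))// lerDl.
by rewrite -ltr_pdivlMl// mulrC.
Qed.

End holomorphic.

(** * Means over arcs *)

Section power_inequalities.
Context {R : realType}.
Implicit Types (u v w p q s : R).

(** The sum is at most twice the larger term; this also covers exponents below 1. *)
Lemma powR_quasi_triangle u v p : 0 <= u -> 0 <= v -> 0 < p ->
  (u + v) `^ p <= 2 `^ p * (u `^ p + v `^ p).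
Proof.
move=> u0 v0 p0; wlog uv : u v u0 v0 / u <= v => [wl|].
  by have [/wl|/ltW/wl] := leP u v; [exact|rewrite (addrC u) (addrC (u `^ p)); exact].
apply: (@le_trans _ _ ((2 * v) `^ p)).
  by rewrite ge0_ler_powR ?nnegrE ?addr_ge0 ?mulr_ge0 ?(ltW p0)//; lra.
by rewrite powRM// ler_wpM2l ?powR_ge0// lerDr powR_ge0.
Qed.

Lemma powR_le1D u p q : 0 <= u -> p <= q -> 0 < p -> u `^ p <= 1 + u `^ q.
Proof.
move=> u0 pq p0; have [u1|/ltW u1] := leP u 1.
  rewrite (@le_trans _ _ (1 `^ p)) ?ge0_ler_powR ?nnegrE ?(ltW p0) ?(ltW u1)//.
  by rewrite powR1 lerDl powR_ge0.
by rewrite (@le_trans _ _ (u `^ q)) ?lerDr// ler_powR.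
Qed.

(* Either w <= l u, and then v >= (1 - l) u, or u < w / l, and then
   u^q <= N^(q-p) u^p is controlled by w^p. *)
Lemma powR_perturbation p q s (N : R) : 0 < p -> p < q -> 0 < s < 1 -> 0 < N ->
  exists2 K : R, 0 < K & forall u v w, 0 <= u <= N -> 0 <= v -> 0 <= w ->
    u <= v + w -> s * u `^ q <= v `^ q + K * w `^ p.
Proof.
move=> p0 pq /andP[s0 s1] N0; have q0 : 0 < q := lt_trans p0 pq.
(* [m] is the [q]-th root of [s], so that [s u^q = (m u)^q]. *)
pose m := s `^ q^-1; have m0 : 0 < m by exact: powR_gt0.
have m1 : m < 1.
  have : m < 1 `^ q^-1 by rewrite gt0_ltr_powR ?invr_gt0 ?nnegrE ?(ltW s0).
  by rewrite powR1.
have mq : m `^ q = s by rewrite -powRrM mulVf ?gt_eqF// powRr1// ltW.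
pose l := 1 - m; have l0 : 0 < l by rewrite /l; lra.
exists (N `^ (q - p) * l^-1 `^ p).
  by rewrite mulr_gt0 ?powR_gt0 ?invr_gt0.
move=> u v w /andP[u0 uN] v0 w0 uvw.
have [wl|lw] := leP w (l * u).
  apply: (@le_trans _ _ (v `^ q)); last by rewrite lerDl !mulr_ge0 ?powR_ge0.
  rewrite -mq -powRM ?(ltW m0)// ge0_ler_powR ?nnegrE ?mulr_ge0 ?(ltW m0) ?(ltW q0)//.
  by move: wl; rewrite /l mulrBl mul1r; lra.
rewrite -[leLHS]add0r lerD ?powR_ge0//.
apply: (@le_trans _ _ (u `^ q)); first by rewrite ler_piMl ?powR_ge0 ?ltW.
have [->|un0] := eqVneq u 0.
  by rewrite powR0 ?gt_eqF// !mulr_ge0 ?powR_ge0.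
have -> : u `^ q = u `^ (q - p) * u `^ p.
  by rewrite -powRD ?subrK// un0 implybT.
rewrite -mulrA ler_pM ?powR_ge0//.
  by rewrite ge0_ler_powR ?nnegrE ?subr_ge0 ?(ltW pq) ?(ltW N0).
rewrite -powRM ?invr_ge0 ?(ltW l0)//.
rewrite ge0_ler_powR ?nnegrE ?mulr_ge0 ?invr_ge0 ?(ltW l0) ?(ltW p0)//.
by rewrite ler_pdivlMl// ltW.
Qed.

End power_inequalities.

(** * Integral means on circles and their suprema *)

Section circle_means.
Context {R : realType}.
Implicit Types (f g : R[i] -> R[i]) (p q a b r : R).

Definition circle_pow p f r t : R := normc (f (polar r t)) `^ p.

Lemma circle_pow_ge0 p f r t : 0 <= circle_pow p f r t.
Proof. exact: powR_ge0. Qed.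

Lemma measurable_circle_pow p f r : holomorphic_disc f -> 0 < r < 1 ->
  measurable_fun setT (circle_pow p f r).
Proof.
move=> hf r01; apply: (@measurableT_comp _ _ _ _ _ _ (@powR R ^~ p)).
  exact: measurable_powR.
by apply: continuous_measurable_fun; exact: holomorphic_circle_continuous.
Qed.

Lemma seg_int_le_sup_mean p a b f r : 0 < r < 1 ->
  (seg_int a b (circle_pow p f r) <= sup_mean p a b f)%E.
Proof.
by move=> r01; apply: ereal_sup_ubound; exists r => //=; rewrite in_itv.
Qed.

Lemma sup_mean_leP p a b f (B : \bar R) :
  (forall r, 0 < r < 1 -> (seg_int a b (circle_pow p f r) <= B)%E) ->
  (sup_mean p a b f <= B)%E.
Proof.
by move=> fB; apply: ge_ereal_sup => _ [r /= + <-]; rewrite in_itv => /fB.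
Qed.

Lemma sup_mean_ge0 p a b f : (0 <= sup_mean p a b f)%E.
Proof.
have h : 0 < (2^-1 : R) < 1 by lra.
apply: le_trans (seg_int_le_sup_mean p a b f h).
by apply: seg_int_ge0 => t; exact: circle_pow_ge0.
Qed.

Lemma sup_mean_fin p a b f : (sup_mean p a b f < +oo)%E ->
  exists2 B : R, 0 <= B & sup_mean p a b f = B%:E.
Proof.
have := sup_mean_ge0 p a b f; case: sup_mean => // B; rewrite lee_fin => B0 _.
by exists B.
Qed.

Lemma sup_meanD_lty p a b f g : 0 < p -> holomorphic_disc f -> holomorphic_disc g ->
  (sup_mean p a b f < +oo)%E -> (sup_mean p a b g < +oo)%E ->
  (sup_mean p a b (fun z => f z + g z)%R < +oo)%E.
Proof.
move=> p0 hf hg /sup_mean_fin[A A0 fA] /sup_mean_fin[B B0 gB].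
apply: (@le_lt_trans _ _ (2 `^ p * (A + B))%:E); last exact: ltry.
apply: sup_mean_leP => r r01.
have mf := measurable_circle_pow p hf r01.
have mg := measurable_circle_pow p hg r01.
have mfg : measurable_fun setT (fun t => circle_pow p f r t + circle_pow p g r t).
  exact: measurable_funD.
apply: (@le_trans _ _ (seg_int a b
    (fun t => 2 `^ p * (circle_pow p f r t + circle_pow p g r t)))).
  apply: le_seg_int.
  - exact: (measurable_circle_pow p (holomorphicD hf hg)).
  - by apply: measurable_funM.
  - by move=> t; exact: circle_pow_ge0.
  - move=> t _; apply: le_trans (powR_quasi_triangle _ _ p0);
      rewrite ?normc_ge0//.
    by rewrite ge0_ler_powR ?nnegrE ?addr_ge0 ?normc_ge0 ?(ltW p0)// le_normcD.
rewrite seg_intZ// ?powR_ge0//; last first.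
  by move=> t; rewrite addr_ge0// circle_pow_ge0.
rewrite seg_intD//; try exact: circle_pow_ge0.
rewrite EFinM; apply: lee_wpmul2l; first by rewrite lee_fin powR_ge0.
by rewrite EFinD -fA -gB; apply: leeD; exact: seg_int_le_sup_mean.
Qed.

Lemma sup_meanZ_le p a b f (c : R[i]) : 0 < p -> holomorphic_disc f ->
  (sup_mean p a b (fun z => c * f z)%R <= (normc c `^ p)%:E * sup_mean p a b f)%E.
Proof.
move=> p0 hf; apply: sup_mean_leP => r r01.
have -> : circle_pow p (fun z => c * f z) r =
    (fun t => normc c `^ p * circle_pow p f r t).
  by apply/funext => t; rewrite /circle_pow normcM powRM ?normc_ge0.
rewrite seg_intZ ?powR_ge0//; last 2 first.
- exact: measurable_circle_pow.
- by move=> t; exact: circle_pow_ge0.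
by rewrite lee_wpmul2l ?lee_fin ?powR_ge0// seg_int_le_sup_mean.
Qed.

(** On a bounded arc [u^p <= 1 + u^q] bounds the smaller exponent by the larger one. Countably many
    exponents and rational arcs can therefore control all of them. *)
Lemma sup_mean_lty_sub p q a b a' b' f : 0 < p -> p <= q -> a' <= a -> b <= b' ->
  holomorphic_disc f ->
  (sup_mean q a' b' f < +oo)%E -> (sup_mean p a b f < +oo)%E.
Proof.
move=> p0 pq aa bb hf /sup_mean_fin[B B0 fB].
have [ba|ab] := ltP b a.
  apply: (@le_lt_trans _ _ 0%E) => //; apply: sup_mean_leP => r r01.
  by rewrite /seg_int set_itv_ge ?integral_set0// bnd_simp -ltNge.
apply: (@le_lt_trans _ _ ((b - a) + B)%:E); last exact: ltry.
apply: sup_mean_leP => r r01.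
have mf s := measurable_circle_pow s hf r01.
apply: (@le_trans _ _ (seg_int a b (fun t => 1 + circle_pow q f r t)%R)).
  apply: le_seg_int => //.
  - exact: measurable_funD.
  - by move=> t; exact: circle_pow_ge0.
  - by move=> t _; apply: powR_le1D => //; exact: normc_ge0.
rewrite seg_intD//; last by move=> t; exact: circle_pow_ge0.
rewrite seg_int_cst// mul1r (EFinD (b - a) B); apply: leeD => //; rewrite -fB.
apply: le_trans (seg_int_le_sup_mean q a' b' f r01).
by apply: seg_int_sub => // t; exact: circle_pow_ge0.
Qed.

(** As [f] is bounded on the arc, [powR_perturbation] gives [s |f|^q <= |g|^q + K |g - f|^p] there.
    Integrating with [s] near 1 keeps the mean of [g] above [M] once the [p]-mean of [g - f] is
    small. *)
Lemma seg_int_circle_pow_lsc p q a b r (M : R) f : 0 < p -> p < q -> 0 <= M ->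
  0 < r < 1 -> holomorphic_disc f -> (M%:E < seg_int a b (circle_pow q f r))%E ->
  exists2 e : R, 0 < e & forall g, holomorphic_disc g ->
    (sup_mean p 0 (2 * pi)%R (fun z => g z - f z)%R < e%:E)%E ->
    (M%:E < seg_int a b (circle_pow q g r))%E.
Proof.
move=> p0 pq M0 r01 hf Mf.
have ab : a <= b.
  rewrite leNgt; apply: contraTN Mf => ba.
  by rewrite /seg_int set_itv_ge ?integral_set0 -?leNgt ?lee_fin// bnd_simp -ltNge.
have [N N0 fN] : exists2 N : R, 0 < N &
    forall t, a <= t <= b -> normc (f (polar r t)) <= N.
  have cf := holomorphic_circle_continuous hf r01.
  have [c _ fc] := EVT_max ab (continuous_subspaceT cf).
  exists (normc (f (polar r c)) + 1); first by rewrite ltr_wpDl ?normc_ge0.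
  by move=> t tab; rewrite (le_trans (fc t _)) ?lerDl// in_itv.
have [m Mm mf] : exists2 m : R, M < m & (m%:E <= seg_int a b (circle_pow q f r))%E.
  move: Mf; case: seg_int => [m||]//; first by rewrite lte_fin; exists m.
  by exists (M + 1); rewrite ?ltrDl// leey.
have m0 : 0 < m := le_lt_trans M0 Mm.
(* The midpoint of [M / m] and 1, so that [s < 1] and still [s m > M]. *)
pose s := (M / m + 1) / 2.
have Mm1 : M / m < 1 by rewrite ltr_pdivrMr// mul1r.
have Mm0 : 0 <= M / m by rewrite divr_ge0// ltW.
have s01 : 0 < s < 1 by rewrite /s; lra.
have Msm : M < s * m.
  by rewrite -ltr_pdivrMr// /s; lra.
have [K K0 fK] := powR_perturbation p0 pq s01 N0.
have [L L0 cover] :=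
  @seg_int_periodic_cover R (2 * pi) a b (mulr_gt0 (ltr0Sn _ 1) (pi_gt0 R)).
(* [K] comes from the pointwise inequality, [L] from comparing the arc with the full circle; this
   radius keeps the total loss below [s m - M]. *)
exists ((s * m - M) / (K * L)).
  by rewrite divr_gt0 ?mulr_gt0// subr_gt0.
move=> g hg gf.
have hgf := holomorphicB hg hf.
have mgf := measurable_circle_pow p hgf r01.
have mg := measurable_circle_pow q hg r01.
have mfq := measurable_circle_pow q hf r01.
have s0 : 0 <= s by case/andP: s01 => /ltW.
have : (s%:E * m%:E <= seg_int a b (circle_pow q g r) +
    K%:E * seg_int a b (circle_pow p (fun z => g z - f z)%R r))%E.
  apply: (@le_trans _ _ (s%:E * seg_int a b (circle_pow q f r))%E).
    by rewrite lee_wpmul2l ?lee_fin.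
  rewrite -!seg_intZ ?(ltW K0)//; try (by move=> t; exact: circle_pow_ge0).
  rewrite -seg_intD//; first last.
  - by move=> t; rewrite mulr_ge0 ?(ltW K0) ?circle_pow_ge0.
  - by move=> t; exact: circle_pow_ge0.
  - exact: measurable_funM.
  apply: le_seg_int.
  - exact: measurable_funM.
  - by apply: measurable_funD => //; exact: measurable_funM.
  - by move=> t; rewrite mulr_ge0 ?circle_pow_ge0.
  move=> t tab; apply: fK; rewrite ?normc_ge0 ?fN//.
  rewrite (normcB (g _)); apply: le_trans (le_normcD _ _).
  by rewrite addrC subrK.
have gfL : (seg_int a b (circle_pow p (fun z => g z - f z)%R r) <=
    L%:E * seg_int 0 (2 * pi) (circle_pow p (fun z => g z - f z)%R r))%E.
  apply: cover => // t; first exact: circle_pow_ge0.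
  by rewrite /circle_pow polarD2pi.
have {}gfL : (K%:E * seg_int a b (circle_pow p (fun z => g z - f z)%R r) <
    (s * m - M)%:E)%E.
  have -> : s * m - M = K * (L * ((s * m - M) / (K * L))).
    by field; rewrite !gt_eqF.
  rewrite EFinM lte_pmul2l// EFinM (le_lt_trans gfL)// lte_pmul2l//.
  by rewrite (le_lt_trans _ gf)// seg_int_le_sup_mean.
move=> smg; rewrite ltNge; apply/negP => gM.
have gfin : seg_int a b (circle_pow q g r) \is a fin_num.
  rewrite ge0_fin_numE; first exact: le_lt_trans gM (ltry _).
  by apply: seg_int_ge0 => t; exact: circle_pow_ge0.
have := le_lt_trans smg (lee_ltD gfin gM gfL).
by rewrite -EFinM -EFinD lte_fin addrC subrK ltxx.
Qed.

End circle_means.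

(** * The Poisson kernel *)

Section poisson_kernel.
Context {R : realType}.
Implicit Types (x y t s : R) (k m : nat).

Lemma normr_sin_le y : `|sin y| <= `|y|.
Proof.
wlog y0 : y / 0 <= y => [wl|].
  have [y0|/ltW y0] := leP 0 y; first exact: wl.
  by rewrite -normrN -sinN -[leRHS]normrN; apply: wl; rewrite oppr_ge0.
have [c _] : exists2 c, c \in `[0, y]%R & sin y - sin 0 = cos c * (y - 0).
  apply: MVT_segment => //; exact/continuous_subspaceT/continuous_sin.
rewrite sin0 !subr0 => ->; rewrite normrM ler_piMl//.
by rewrite ler_norml cos_geN1 cos_le1.
Qed.

Lemma cos_ge1B_sqr t : 1 - t ^+ 2 <= cos t.
Proof.
have -> : cos t = 1 - 2 * sin (t / 2) ^+ 2.
  have {1}-> : t = t / 2 + t / 2 by field.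
  rewrite cosD -!expr2; have := cos2Dsin2 (t / 2); lra.
have : sin (t / 2) ^+ 2 <= (t / 2) ^+ 2.
  rewrite -(real_normK (num_real (sin _))).
  rewrite -[leRHS](real_normK (num_real (t / 2))).
  by rewrite lerXn2r ?nnegrE// normr_sin_le.
have := sqr_ge0 t; rewrite !expr2; lra.
Qed.

(** This is [|1 - x e^(it)|^2]. *)
Definition sqdist x t : R := 1 - 2 * x * cos t + x ^+ 2.

Lemma sqdist_ge x t : 0 <= x -> (1 - x) ^+ 2 <= sqdist x t.
Proof.
move=> x0; have : x * cos t <= x * 1 by rewrite ler_wpM2l// cos_le1.
rewrite /sqdist !expr2; lra.
Qed.

Lemma sqdist_gt0 x t : 0 <= x < 1 -> 0 < sqdist x t.
Proof.
move=> /andP[x0 x1]; apply: lt_le_trans (sqdist_ge t x0).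
by rewrite exprn_gt0// subr_gt0.
Qed.

(** The Poisson kernel without the factor [1 / (2 pi)]; [poisson_sum] below is its partial Fourier
    sum. *)
Definition poisson x t : R := (1 - x ^+ 2) / sqdist x t.

Definition poisson_sum x m t : R :=
  1 + 2 * \sum_(k < m) x ^+ k.+1 * cos (k.+1%:R * t).

(* The remainder is the real part of 2 u^(m+1) / (1 - u) for u = x e^(it). *)
Lemma poissonE x t m : 0 <= x < 1 -> poisson x t = poisson_sum x m t +
  2 * x ^+ m.+1 * (cos (m.+1%:R * t) - x * cos (m%:R * t)) / sqdist x t.
Proof.
move=> x01; have N0 := lt0r_neq0 (sqdist_gt0 t x01).
elim: m => [|m IH].
  rewrite /poisson_sum big_ord0 mulr0 addr0 mul1r mul0r cos0 expr1 mulr1.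
  by rewrite /poisson; move: N0; rewrite /sqdist => N0; field.
rewrite IH /poisson_sum big_ord_recr/=; set S := \sum_(k < m) _.
(* This recurrence matches the coefficients of [sqdist], so consecutive remainders differ by exactly
   one cosine term. *)
have cosrec : cos (m.+2%:R * t) = 2 * cos t * cos (m.+1%:R * t) - cos (m%:R * t).
  have -> : m.+2%:R * t = m.+1%:R * t + t by rewrite -natr1; ring.
  have -> : m%:R * t = m.+1%:R * t - t by rewrite -natr1; ring.
  rewrite cosD cosB; ring.
apply: (mulIf N0); rewrite [LHS]mulrDl [RHS]mulrDl !divfK// cosrec.
by rewrite /sqdist (exprS x m.+1); ring.
Qed.

(** The remainder is at most [4 x^(m+1) / (1 - x)^2] for every [t], hence at most 1 for large [m].
    Bounding the integral of the kernel thus reduces to integrating a finite sum. *)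
Lemma poisson_le x : 0 <= x < 1 -> exists m, forall t,
  poisson x t <= 1 + poisson_sum x m t.
Proof.
move=> /[dup] x01 /andP[x0 x1].
have e0 : 0 < (1 - x) ^+ 2 / 4 by rewrite divr_gt0// exprn_gt0// subr_gt0.
have : (x ^+ n @[n --> \oo] --> 0).
  by apply: cvg_expr; rewrite ger0_norm.
move=> /cvgrPdist_lt/(_ _ e0)[m _ /(_ m.+1 (leqnSn m))].
rewrite sub0r normrN ger0_norm ?exprn_ge0// => xm; exists m => t.
rewrite (poissonE t m x01) addrC lerD2r.
have N0 := sqdist_gt0 t x01.
rewrite ler_pdivrMr// mul1r; apply: le_trans (sqdist_ge t x0).
apply: (@le_trans _ _ (2 * x ^+ m.+1 * 2)); last by lra.
rewrite ler_wpM2l ?mulr_ge0 ?exprn_ge0//.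
have := cos_le1 (m.+1%:R * t).
have : x * - cos (m%:R * t) <= x * 1.
  by rewrite ler_wpM2l// lerNl cos_geN1.
lra.
Qed.

Lemma poisson_ge0 x t : 0 <= x < 1 -> 0 <= poisson x t.
Proof.
move=> x01; rewrite divr_ge0 ?(ltW (sqdist_gt0 t x01))//.
by case/andP: x01 => x0 x1; rewrite subr_ge0 exprn_ile1// ltW.
Qed.

Lemma continuous_poisson x s : 0 <= x < 1 -> continuous (fun t => poisson x (s + t)).
Proof.
move=> x01 t.
have ct : cos (s + y) @[y --> t] --> cos (s + t).
  apply: (cvg_comp (fun y => s + y) cos); last exact: continuous_cos.
  by apply: cvgD; [exact: cvg_cst|exact: cvg_id].
apply: cvgM; first exact: cvg_cst.
apply: cvgV; first by rewrite gt_eqF// sqdist_gt0.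
apply: cvgD; last exact: cvg_cst.
apply: cvgB; first exact: cvg_cst.
by apply: cvgM => //; exact: cvg_cst.
Qed.

Lemma continuous_poisson_sum x m s :
  continuous (fun t => 1 + poisson_sum x m (s + t)).
Proof.
move=> t; apply: cvgD; first exact: cvg_cst.
apply: cvgD; first exact: cvg_cst.
apply: cvgM; first exact: cvg_cst.
apply: cvg_big => [|k _]; first exact: add_continuous.
apply: cvgM; first exact: cvg_cst.
apply: (cvg_comp (fun y => k.+1%:R * (s + y)) cos); last exact: continuous_cos.
apply: cvgM; first exact: cvg_cst.
by apply: cvgD; [exact: cvg_cst|exact: cvg_id].
Qed.

(** Every cosine has an antiderivative of period [2 pi] and contributes nothing, so only the
    constant [1 + 1] remains. *)
Lemma poisson_sum_integral x m s :
  (seg_int 0 (2 * pi) (fun t => (1 + poisson_sum x m (s + t))%R) = (4 * pi)%:E)%E.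
Proof.
pose h k t : R := x ^+ k.+1 / k.+1%:R * sin (k.+1%:R * (s + t)).
have dh k t : is_derive t 1 (h k) (x ^+ k.+1 * cos (k.+1%:R * (s + t))).
  have da : is_derive t 1 (fun y => k.+1%:R * (s + y)) k.+1%:R.
    have : is_derive t 1 (k.+1%:R \*: (cst s + id : R -> R)) (k.+1%:R *: (0 + 1)).
      exact: is_deriveZ.
    by rewrite add0r /GRing.scale/= mulr1.
  have ds := @is_derive1_comp _ sin _ _ _ _ (is_derive_sin _) da.
  have := is_deriveZ (x ^+ k.+1 / k.+1%:R) ds.
  rewrite /GRing.scale/=; congr is_derive.
  by field; rewrite ?nat1r ?natr1 pnatr_eq0.
pose F := (2 \*: id) + (2 \*: \sum_(k < m) h k) : R -> R.
pose f t := 1 + poisson_sum x m (s + t).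
have dF t : is_derive t 1 F (f t).
  have := @is_derive_sum _ _ _ m (fun k : 'I_m => h k) t 1 _
    (fun k : 'I_m => dh k t).
  move=> /(is_deriveZ 2)/(is_deriveD (is_deriveZ 2 (is_derive_id t 1))).
  rewrite /f /poisson_sum /GRing.scale/= mulr1 addrA.
  by congr is_derive.
have cf : continuous f by exact: continuous_poisson_sum.
have cF : continuous F.
  move=> t; apply: differentiable_continuous; apply/derivable1_diffP.
  exact: ex_derive.
rewrite /seg_int (@continuous_FTC2 _ f F)//.
- rewrite -EFinB; congr EFin; rewrite /F !fctE/= !fct_sumE/=.
  rewrite (_ : \sum_(k < m) h k (2 * pi) = \sum_(k < m) h k 0); last first.
    apply: eq_bigr => k _; rewrite /h; congr (_ * _); rewrite addr0 mulrDr.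
    have -> : k.+1%:R * (2 * pi) = (pi *+ 2) *+ k.+1 :> R.
      by rewrite -(mulr_natl pi) -(mulr_natl (2 * pi)).
    by rewrite (periodicn (@sinD2pi R)).
  rewrite /GRing.scale/=; ring.
- by rewrite mulr_gt0// pi_gt0.
- exact: continuous_subspaceT.
- split => [t _||]; first exact: ex_derive.
  + exact/cvg_at_right_filter/cF.
  + exact/cvg_at_left_filter/cF.
- by move=> t _; rewrite derive1E; exact: derive_val.
Qed.

Lemma poisson_integral x s : 0 <= x < 1 ->
  (seg_int 0 (2 * pi) (fun t => poisson x (s + t)%R) <= (4 * pi)%:E)%E.
Proof.
move=> x01; have [m xm] := poisson_le x01.
rewrite -(poisson_sum_integral x m s); apply: le_seg_int.
- by apply: continuous_measurable_fun; exact: continuous_poisson.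
- by apply: continuous_measurable_fun; exact: continuous_poisson_sum.
- by move=> t; exact: poisson_ge0.
- by move=> t _; exact: xm.
Qed.

End poisson_kernel.

(** * Series of Cauchy kernels *)

Section complex_series.
Context {R : realType}.
Implicit Types (u : nat -> R[i]) (v : nat -> R).

(** Summing the two parts separately gives access to real series; the value is meaningful when both
    converge. *)
Definition csum u : R[i] :=
  limn (series (fun n => Re (u n))) +i* limn (series (fun n => Im (u n))).

Lemma cvgn_series_dominated (x v : nat -> R) : (forall n, `|x n| <= v n) ->
  cvgn (series v) -> cvgn (series x).
Proof.
move=> xv cv; apply: normed_cvg; apply: (series_le_cvg _ _ xv) => // n.
exact: le_trans (normr_ge0 _) (xv n).
Qed.

Lemma limn_series_dominated (x v : nat -> R) : (forall n, `|x n| <= v n) ->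
  cvgn (series v) -> `|limn (series x)| <= limn (series v).
Proof.
move=> xv cv; have cx : cvgn [normed series x].
  apply: (series_le_cvg _ _ xv) => // n; exact: le_trans (normr_ge0 _) (xv n).
by apply: (le_trans (lim_series_norm cx)); apply: lim_series_le.
Qed.

Lemma cvgn_series_Re u v : (forall n, normc (u n) <= v n) -> cvgn (series v) ->
  cvgn (series (fun n => Re (u n))).
Proof.
move=> uv; apply: cvgn_series_dominated => n.
exact: le_trans (normr_Re_le _) (uv n).
Qed.

Lemma cvgn_series_Im u v : (forall n, normc (u n) <= v n) -> cvgn (series v) ->
  cvgn (series (fun n => Im (u n))).
Proof.
move=> uv; apply: cvgn_series_dominated => n.
exact: le_trans (normr_Im_le _) (uv n).
Qed.

(** The factor 2 is the cost of bounding the real and imaginary parts separately. *)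
Lemma normc_csum_le u v : (forall n, normc (u n) <= v n) -> cvgn (series v) ->
  normc (csum u) <= 2 * limn (series v).
Proof.
move=> uv cv; apply: (le_trans (normc_le_ReIm _)); rewrite mulr2n mulrDl !mul1r.
apply: lerD; apply: limn_series_dominated => // n; apply: le_trans (uv n).
  exact: normr_Re_le.
exact: normr_Im_le.
Qed.

Lemma csumB u (u' : nat -> R[i]) v (v' : nat -> R) :
  (forall n, normc (u n) <= v n) -> cvgn (series v) ->
  (forall n, normc (u' n) <= v' n) -> cvgn (series v') ->
  csum (fun n => u n - u' n) = csum u - csum u'.
Proof.
move=> uv cv uv' cv'.
have cR := cvgn_series_Re uv cv; have cI := cvgn_series_Im uv cv.
have cR' := cvgn_series_Re uv' cv'; have cI' := cvgn_series_Im uv' cv'.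
apply/eqP; rewrite eq_complex ReB ImB; apply/andP; split; apply/eqP => /=.
  rewrite -lim_seriesB//; congr (limn (series _)); apply/funext => n.
  exact: ReB.
rewrite -lim_seriesB//; congr (limn (series _)); apply/funext => n.
exact: ImB.
Qed.

Lemma csumZ (c : R[i]) u v : (forall n, normc (u n) <= v n) -> cvgn (series v) ->
  csum (fun n => c * u n) = c * csum u.
Proof.
move=> uv cv.
have cR := cvgn_series_Re uv cv; have cI := cvgn_series_Im uv cv.
have cZ (k : R) (x : nat -> R) : cvgn (series x) -> cvgn (series (k *: x)).
  exact: is_cvg_seriesZ.
have lZ (k : R) (x : nat -> R) : cvgn (series x) ->
    k * limn (series x) = limn (series (k *: x)).
  by move=> cx; rewrite lim_seriesZ.
case: c => c d; apply/eqP; rewrite eq_complex; apply/andP; split; apply/eqP.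
  have -> : Re ((c +i* d) * csum u) = c * Re (csum u) - d * Im (csum u) by [].
  rewrite /= (lZ c _ cR) (lZ d _ cI) -lim_seriesB; try exact: cZ.
  by congr (limn (series _)); apply/funext => n; rewrite !fctE; case: (u n).
have -> : Im ((c +i* d) * csum u) = c * Im (csum u) + d * Re (csum u) by [].
rewrite /= (lZ c _ cI) (lZ d _ cR) -lim_seriesD; try exact: cZ.
by congr (limn (series _)); apply/funext => n; rewrite !fctE; case: (u n).
Qed.

(** The real parts of the partial sums increase, so no cancellation can hide a single term. *)
Lemma Re_csum_ge u v k : (forall n, normc (u n) <= v n) -> cvgn (series v) ->
  (forall n, 0 <= Re (u n)) -> Re (u k) <= Re (csum u).
Proof.
move=> uv cv u0; have cR := cvgn_series_Re uv cv.
have ndR : nondecreasing_seq (series (fun n => Re (u n))).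
  exact: nondecreasing_series.
apply: le_trans (nondecreasing_cvgn_le ndR cR k.+1).
rewrite /series/= big_nat_recr//= lerDr.
by apply: sumr_ge0 => n _.
Qed.

End complex_series.

(** * Positivity and holomorphy of a sum of Cauchy kernels *)

Section cauchy_series.
Context {R : realType}.
Variables (a : nat -> R) (w : nat -> R[i]).
Hypotheses (a0 : forall n, 0 <= a n) (suma : cvgn (series a)).
Hypothesis (w1 : forall n, normc (w n) < 1).

Definition cauchy_term (z : R[i]) n : R[i] := (a n)%:C * (1 - w n * z)^-1.

Definition cauchy_series (z : R[i]) : R[i] :=
  if normc z < 1 then csum (cauchy_term z) else 0.

Lemma normc_den_ge (z : R[i]) n : 1 - normc z <= normc (1 - w n * z).
Proof.
have := le_normcD (1 - w n * z) (w n * z); rewrite subrK normc1 normcM.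
have : normc (w n) * normc z <= 1 * normc z.
  by rewrite ler_wpM2r ?normc_ge0// ltW.
lra.
Qed.

Lemma den_neq0 (z : R[i]) n : normc z < 1 -> 1 - w n * z != 0.
Proof.
move=> z1; apply: contraTneq z1 => e; have := normc_den_ge z n.
by rewrite e normc0 -leNgt subr_le0.
Qed.

Lemma normc_cauchy_term (z : R[i]) n :
  normc (cauchy_term z n) = a n / normc (1 - w n * z).
Proof. by rewrite normcM normc_real ger0_norm// normcV. Qed.

Lemma normc_cauchy_term_le (z : R[i]) n : normc z < 1 ->
  normc (cauchy_term z n) <= (1 - normc z)^-1 * a n.
Proof.
move=> z1; rewrite normc_cauchy_term mulrC ler_wpM2r//.
rewrite lef_pV2 ?posrE ?subr_gt0//; first exact: normc_den_ge.
by rewrite (lt_le_trans _ (normc_den_ge z n))// subr_gt0.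
Qed.

Lemma cvgn_cauchy_bound (c : R) : cvgn (series (fun n => c * a n)).
Proof. exact: (@is_cvg_seriesZ R _ c suma). Qed.

(** As [|w z| <= 1], the denominator lies in the closed right half-plane, which inversion
    preserves. *)
Lemma Re_inv_den_ge0 (z : R[i]) n : normc z < 1 -> 0 <= Re (1 - w n * z)^-1.
Proof.
move=> z1; have : `|Re (w n * z)| <= 1.
  apply: (le_trans (normr_Re_le _)).
  by rewrite normcM mulr_ile1 ?normc_ge0// ltW.
rewrite ler_norml => /andP[_].
case: (w n * z) => x y /= x1; apply: divr_ge0; first by rewrite subr_ge0.
by rewrite addr_ge0 ?sqr_ge0.
Qed.

Lemma Re_cauchy_term (z : R[i]) n :
  Re (cauchy_term z n) = a n * Re (1 - w n * z)^-1.
Proof.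
by rewrite /cauchy_term; case: (_^-1) => x y /=; rewrite mul0r subr0.
Qed.

Lemma Re_cauchy_series_ge (z : R[i]) n : normc z < 1 ->
  a n * Re (1 - w n * z)^-1 <= Re (cauchy_series z).
Proof.
move=> z1; rewrite /cauchy_series z1 -Re_cauchy_term.
apply: (Re_csum_ge n (fun n => normc_cauchy_term_le n z1)).
  exact: cvgn_cauchy_bound.
by move=> k; rewrite Re_cauchy_term mulr_ge0// Re_inv_den_ge0.
Qed.

(** Differentiation term by term: the remainders are dominated by [d^-3 a_n |h|^2], and their sum is
    the error allowed by [derivable_quadratic]. *)
Lemma holomorphic_cauchy_series : holomorphic_disc cauchy_series.
Proof.
split=> [z z1|z /negP z1]; last by rewrite /cauchy_series (negPf z1).
rewrite /unit_disc/mkset in z1.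
(* Half the distance to the circle: for [|h| < d] the denominators at [z] and [z + h] are at least
   [d] in modulus. *)
pose d := (1 - normc z) / 2; have d0 : 0 < d by rewrite /d; lra.
pose l n := (a n)%:C * (w n * (1 - w n * z)^-1 ^+ 2).
have dz n : d <= normc (1 - w n * z).
  by apply: le_trans (normc_den_ge z n); rewrite /d; lra.
have l_le n : normc (l n) <= d^-1 ^+ 2 * a n.
  rewrite normcM normc_real ger0_norm// mulrC ler_wpM2r// normcM normcX normcV.
  rewrite -[leRHS]mul1r ler_pM ?normc_ge0 ?exprn_ge0 ?invr_ge0 ?normc_ge0//.
    exact: ltW.
  rewrite lerXn2r ?nnegrE ?invr_ge0 ?normc_ge0 ?(ltW d0)//.
  by rewrite lef_pV2 ?posrE// (lt_le_trans d0).
pose K := 2 * (d^-1 ^+ 3 * limn (series a)).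
apply: (@derivable_quadratic _ _ z (csum l) d K) => // h hd; rewrite {}/K.
have zh1 : normc (z + h) < 1.
  by apply: (le_lt_trans (le_normcD _ _)); move: hd; rewrite /d; lra.
have dzh n : d <= normc (1 - w n * (z + h)).
  apply: le_trans (normc_den_ge (z + h) n).
  have := le_normcD z h; move: hd; rewrite /d; lra.
rewrite /cauchy_series zh1 z1.
have t1 := fun n => normc_cauchy_term_le n zh1.
have t2 := fun n => normc_cauchy_term_le n z1.
have cB := cvgn_cauchy_bound.
have t12 n : normc (cauchy_term (z + h) n - cauchy_term z n) <=
    ((1 - normc (z + h))^-1 + (1 - normc z)^-1) * a n.
  by rewrite mulrDl (le_trans (le_normcD _ _))// normcN lerD.
have hl n : normc (h * l n) <= (normc h * d^-1 ^+ 2) * a n.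
  by rewrite normcM -mulrA ler_wpM2l ?normc_ge0.
rewrite -(csumZ h l_le (cB _)) -(csumB t1 (cB _) t2 (cB _)).
rewrite -(csumB t12 (cB _) hl (cB _)).
have -> : 2 * (d^-1 ^+ 3 * limn (series a)) * normc h ^+ 2 =
    2 * limn (series (normc h ^+ 2 * d^-1 ^+ 3 *: a)).
  by rewrite lim_seriesZ// /GRing.scale/=; ring.
apply: normc_csum_le; last exact: is_cvg_seriesZ.
move=> n.
(* The exact remainder of the first-order expansion, exhibiting the factor [h^2]. *)
have -> : cauchy_term (z + h) n - cauchy_term z n - h * l n =
   h ^+ 2 * ((a n)%:C * (w n ^+ 2 *
     ((1 - w n * (z + h))^-1 * (1 - w n * z)^-1 ^+ 2))).
  have := den_neq0 n zh1; have := den_neq0 n z1.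
  by rewrite /cauchy_term /l => *; field; apply/andP.
rewrite normcM normcX -[leRHS]mulrA ler_wpM2l ?exprn_ge0 ?normc_ge0//.
rewrite normcM normc_real ger0_norm// mulrC ler_wpM2r//.
rewrite normcM normcX -[leRHS]mul1r ler_pM ?mulr_ge0 ?exprn_ge0 ?normc_ge0//.
  by rewrite exprn_ile1 ?normc_ge0// ltW.
rewrite normcM normcX !normcV (exprS _ 2) ler_pM ?exprn_ge0 ?invr_ge0 ?normc_ge0//.
  by rewrite lef_pV2 ?posrE ?(lt_le_trans d0).
rewrite lerXn2r ?nnegrE ?invr_ge0 ?normc_ge0 ?(ltW d0)//.
by rewrite lef_pV2 ?posrE ?(lt_le_trans d0).
Qed.

End cauchy_series.

(** * A function in no better local Hardy space *)

Section witness.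
Context {R : realType}.
Variable P : R.
Hypothesis P2 : 2 <= P.
Implicit Types (n : nat) (r t : R).

Let P0 : 0 < P. Proof. exact: lt_le_trans P2. Qed.

(** A summable weight that enters [amplitude] twice: once to sum the terms, once to sum their
    Poisson majorants. *)
Definition decay n : R := expR (- n%:R).
(** The exponent is quadratic so that the growth it produces beats the loss from [decay], whose
    exponent is linear. *)
Definition pole_gap n : R := expR (- n%:R ^+ 2).
(* amplitude n = decay n ^ 2 * pole_gap n ^ (1 - 1/P): up to the summable
   weight, this normalizes the Cauchy kernel in H^P. *)
Definition amplitude n : R := expR (- (2 * n%:R) - n%:R ^+ 2 * (1 - P^-1)).

(* The second component is dropped so that each rational angle is repeated
   infinitely often. *)
Definition angle n : R :=
  if (unpickle n : option (rat * nat)) is Some (c, _) then ratr c else 0.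

Definition pole_conj n : R[i] := polar (1 - pole_gap n) (- angle n).

Definition witness : R[i] -> R[i] := cauchy_series amplitude pole_conj.

Lemma pole_gap_gt0 n : 0 < pole_gap n. Proof. exact: expR_gt0. Qed.

Lemma pole_gap_le1 n : pole_gap n <= 1.
Proof. by rewrite -expR0 ler_expR oppr_le0 sqr_ge0. Qed.

Lemma decay_ge0 n : 0 <= decay n. Proof. exact: expR_ge0. Qed.

Lemma cvgn_decay : cvgn (series decay).
Proof.
have -> : decay = geometric 1 (expR (- 1)).
  by apply/funext => n; rewrite /geometric/= mul1r -expRM_natl mulrN1.
by apply: is_cvg_geometric_series; rewrite ger0_norm ?expR_ge0// expR_lt1; lra.
Qed.

Lemma decay_series_gt0 : 0 < limn (series decay).
Proof.
have nd : nondecreasing_seq (series decay).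
  by apply: nondecreasing_series => k _ _; exact: decay_ge0.
apply: lt_le_trans (nondecreasing_cvgn_le nd cvgn_decay 1%N).
by rewrite /series/= big_nat1 expR_gt0.
Qed.

Lemma amplitude_ge0 n : 0 <= amplitude n. Proof. exact: expR_ge0. Qed.

Lemma Pinv : 0 < P^-1 <= 2^-1.
Proof. by rewrite invr_gt0 P0 lef_pV2// posrE. Qed.

Lemma cvgn_amplitude : cvgn (series amplitude).
Proof.
apply: series_le_cvg cvgn_decay => n; [exact: expR_ge0|exact: expR_ge0|].
rewrite ler_expR; have /andP[i0 i1] := Pinv.
have : 0 <= n%:R ^+ 2 * (1 - P^-1) by rewrite mulr_ge0 ?sqr_ge0//; lra.
have : 0 <= n%:R :> R by []. lra.
Qed.

Lemma normc_pole_conj n : normc (pole_conj n) = 1 - pole_gap n.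
Proof. by rewrite normc_polar ger0_norm// subr_ge0 pole_gap_le1. Qed.

Lemma normc_pole_conj_lt1 n : normc (pole_conj n) < 1.
Proof. by rewrite normc_pole_conj ltrBlDr ltrDl pole_gap_gt0. Qed.

Lemma holomorphic_witness : holomorphic_disc witness.
Proof.
exact: holomorphic_cauchy_series amplitude_ge0 cvgn_amplitude normc_pole_conj_lt1.
Qed.

Lemma polarM r r' t t' : polar r t * polar r' t' = polar (r * r') (t + t').
Proof.
apply/eqP; rewrite eq_complex /= cosD sinD; apply/andP; split; apply/eqP; ring.
Qed.

Lemma Re_den r t : Re (1 - polar r t) = 1 - r * cos t.
Proof. by []. Qed.

Lemma sqr_normc_den r t : normc (1 - polar r t) ^+ 2 = sqdist r t.
Proof.
rewrite sqr_normcE Re_den /= add0r sqrrN exprMn.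
have -> : sin t ^+ 2 = 1 - cos t ^+ 2 by rewrite -(cos2Dsin2 t); ring.
by rewrite /sqdist; ring.
Qed.

Lemma Re_inv (z : R[i]) : Re z^-1 = Re z / normc z ^+ 2.
Proof. by rewrite sqr_normcE; case: z. Qed.

Lemma radius_lt n r : 0 < r < 1 -> 0 <= (1 - pole_gap n) * r <= 1 - pole_gap n.
Proof.
move=> /andP[r0 r1]; have := pole_gap_le1 n => g1.
by rewrite mulr_ge0 ?subr_ge0 ?(ltW r0)//= ler_piMr ?subr_ge0// ltW.
Qed.

Lemma radius_lt1 n r : 0 < r < 1 -> 0 <= (1 - pole_gap n) * r < 1.
Proof.
move=> /(radius_lt n)/andP[-> /le_lt_trans]; apply.
by rewrite ltrBlDr ltrDl pole_gap_gt0.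
Qed.

Definition term_poisson r n t : R := poisson ((1 - pole_gap n) * r) (- angle n + t).

(** With [D = |1 - w z| >= pole_gap n] and [P >= 2] one has
    [pole_gap^(P-1) / D^P <= pole_gap / D^2], which is below the Poisson kernel. Taking [P]-th roots
    gives the bound. *)
Lemma cauchy_term_le_poisson r t n : 0 < r < 1 ->
  normc (cauchy_term amplitude pole_conj (polar r t) n) <=
  decay n * (decay n * term_poisson r n t) `^ P^-1.
Proof.
move=> r01; have /andP[x0 x1] := radius_lt n r01.
set x := (1 - pole_gap n) * r in x0 x1.
rewrite (normc_cauchy_term pole_conj amplitude_ge0) polarM -/x.
set D := normc _.
have D2 : D ^+ 2 = sqdist x (- angle n + t) by exact: sqr_normc_den.
have gD : pole_gap n <= D.
  rewrite -(@ler_pXn2r _ 2)// ?nnegrE ?normc_ge0 ?(ltW (pole_gap_gt0 n))// D2.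
  apply: le_trans (sqdist_ge _ x0).
  by rewrite lerXn2r ?nnegrE ?(ltW (pole_gap_gt0 n))//; have := pole_gap_gt0 n; lra.
have D0 : 0 < D := lt_le_trans (pole_gap_gt0 n) gD.
pose e := expR (- n%:R - n%:R ^+ 2 * (1 - P^-1)).
have -> : amplitude n = decay n * e.
  by rewrite /decay /e -expRD /amplitude; congr expR; ring.
rewrite -mulrA ler_wpM2l ?decay_ge0//.
have eD0 : 0 <= e / D by rewrite divr_ge0 ?expR_ge0 ?ltW.
have -> : e / D = ((e / D) `^ P) `^ P^-1.
  by rewrite -powRrM mulfV ?gt_eqF// powRr1.
have tp : pole_gap n / D ^+ 2 <= term_poisson r n t.
  rewrite /term_poisson /poisson -/x D2 ler_wpM2r ?invr_ge0 -?D2 ?sqr_ge0//.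
  have x1' : x <= 1 by have := pole_gap_gt0 n; lra.
  by have := ler_wpM2l x0 x1'; rewrite expr2; lra.
have tp0 : 0 <= decay n * term_poisson r n t.
  by apply: mulr_ge0; [exact: decay_ge0|exact: poisson_ge0 (radius_lt1 n r01)].
apply: ge0_ler_powR; rewrite ?nnegrE ?powR_ge0 ?invr_ge0 ?(ltW P0)//.
apply: (@le_trans _ _ (decay n * (pole_gap n / D ^+ 2))); last first.
  by rewrite ler_wpM2l ?decay_ge0.
rewrite powRM ?expR_ge0 ?invr_ge0 ?(ltW D0)//.
(* Only the power [P - 2 >= 0] is bounded through [pole_gap n <= D]; the square is kept for the
   Poisson kernel. *)
have -> : D^-1 `^ P = D^-1 `^ (P - 2) * D^-1 ^+ 2.
  rewrite -powR_mulrn ?invr_ge0 ?(ltW D0)// -powRD ?subrK//.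
  by rewrite invr_eq0 gt_eqF ?implybT.
rewrite exprVn !mulrA ler_wpM2r ?invr_ge0 ?sqr_ge0//.
apply: (@le_trans _ _ (e `^ P * (pole_gap n)^-1 `^ (P - 2))).
  rewrite ler_wpM2l ?powR_ge0// ge0_ler_powR ?nnegrE ?invr_ge0 ?subr_ge0
    ?(ltW D0) ?(ltW (pole_gap_gt0 n))//.
  by rewrite lef_pV2 ?posrE ?pole_gap_gt0.
rewrite /e /pole_gap -expRN -!expRM /decay -!expRD ler_expR opprK.
have -> : (- n%:R - n%:R ^+ 2 * (1 - P^-1)) * P + n%:R ^+ 2 * (P - 2) =
   - (n%:R * P) - n%:R ^+ 2.
  by field; rewrite gt_eqF.
by rewrite lerD2r lerN2 -[leLHS]mulr1 ler_wpM2l// (le_trans _ P2)// ler1n.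
Qed.

End witness.

(** * The witness belongs to [H^P] *)

Section witness_means.
Context {R : realType}.
Variable P : R.
Hypothesis P2 : 2 <= P.
Implicit Types (n : nat) (r t : R).

Local Notation D := (limn (series (@decay R))).

Lemma measurable_term_poisson r n : 0 < r < 1 ->
  measurable_fun setT (fun t => decay n * term_poisson r n t).
Proof.
move=> r01; apply: measurable_funM => //; apply: continuous_measurable_fun.
exact: continuous_poisson (radius_lt1 n r01).
Qed.

Lemma decay_term_poisson_ge0 r n t : 0 < r < 1 ->
  0 <= decay n * term_poisson r n t.
Proof.
move=> r01; apply: mulr_ge0; [exact: decay_ge0|].
exact: poisson_ge0 (radius_lt1 n r01).
Qed.

(** Each majorant is at most the whole sum [y], so the [n]-th term is at most [decay n * y^(1/P)],
    and summing the weights gives the constant. *)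
Lemma witness_pow_le r t : 0 < r < 1 ->
  ((circle_pow P (witness P) r t)%:E <= ((2 * D) `^ P)%:E *
     \sum_(n <oo) (decay n * term_poisson r n t)%:E)%E.
Proof.
move=> r01; have P0 : 0 < P by rewrite (lt_le_trans _ P2).
have z1 : normc (polar r t) < 1 := polar_disc t r01.
have T0 n := decay_term_poisson_ge0 n t r01.
have D0 : 0 < 2 * D by rewrite mulr_gt0// decay_series_gt0.
(* An infinite sum makes the bound trivial. *)
have [ye|ey] : (exists2 y : R, 0 <= y &
    (\sum_(n <oo) (decay n * term_poisson r n t)%:E = y%:E)%E) \/
   (\sum_(n <oo) (decay n * term_poisson r n t)%:E = +oo)%E.
- have : (0 <= \sum_(n <oo) (decay n * term_poisson r n t)%:E)%E.
    by apply: nneseries_ge0 => n _ _; rewrite lee_fin.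
  by case: (\sum_(n <oo) _)%E => [y|_|//]; [left; exists y|right].
- case: ye => y [y0 ye]; rewrite ye -EFinM lee_fin.
  have Ty n : decay n * term_poisson r n t <= y.
    rewrite -lee_fin -ye; apply: (@le_trans _ _ (\sum_(0 <= k < n.+1)
      (decay k * term_poisson r k t)%:E)%E).
      by rewrite big_nat_recr//= leeDr// sume_ge0// => k _; rewrite lee_fin.
    by apply: nneseries_lim_ge => k _ _; rewrite lee_fin.
  have wy : normc (witness P (polar r t)) <= 2 * D * y `^ P^-1.
    rewrite /witness /cauchy_series z1.
    have -> : 2 * D * y `^ P^-1 = 2 * limn (series (y `^ P^-1 *: @decay R)).
      rewrite (lim_seriesZ (y `^ P^-1) (@cvgn_decay R)) -mulrA; congr (_ * _).
      exact: mulrC.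
    apply: normc_csum_le => [n|]; last exact: (is_cvg_seriesZ (@cvgn_decay R)).
    apply: (le_trans (cauchy_term_le_poisson P2 t n r01)).
    rewrite fctE /GRing.scale/= mulrC ler_wpM2r ?decay_ge0//.
    by rewrite ge0_ler_powR ?nnegrE ?invr_ge0 ?(ltW P0).
  apply: (@le_trans _ _ ((2 * D * y `^ P^-1) `^ P)).
    rewrite /circle_pow ge0_ler_powR ?nnegrE ?normc_ge0 ?(ltW P0)//.
    by rewrite mulr_ge0 ?powR_ge0// ltW.
  by rewrite powRM ?powR_ge0 ?(ltW D0)// -powRrM mulVf ?gt_eqF// powRr1.
by rewrite ey gt0_muley ?leey// lte_fin powR_gt0.
Qed.

(** Integration term by term: each kernel has integral at most [4 pi] whatever the radius, and the
    weights are summable. *)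
Lemma sup_mean_witness_lty : (sup_mean P 0 (2 * pi) (witness P) < +oo)%E.
Proof.
apply: (@le_lt_trans _ _ ((2 * D) `^ P * (D * (4 * pi)))%:E); last exact: ltry.
apply: sup_mean_leP => r r01.
have hw := holomorphic_witness P2.
have mw := measurable_circle_pow P hw r01.
have T0 n t := decay_term_poisson_ge0 n t r01.
have mT n := measurable_term_poisson n r01.
have mTE n : measurable_fun `[0, 2 * pi]
    (fun t => (decay n * term_poisson r n t)%:E).
  by apply/measurable_EFinP; exact: measurable_funS (mT n).
have mS : measurable_fun `[0, 2 * pi]
    (fun t => \sum_(n <oo) (decay n * term_poisson r n t)%:E)%E.
  apply: (@ge0_emeasurable_sum _ _ _ _ _ xpredT) => [n t _ _|n _].
    by rewrite lee_fin.
  exact: mTE.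
apply: (@le_trans _ _ (\int[lebesgue_measure]_(t in `[0%R, (2 * pi)%R])
   (((2 * D) `^ P)%:E * \sum_(n <oo) (decay n * term_poisson r n t)%:E))%E).
  apply: ge0_le_integral => //.
  - by move=> t _; rewrite lee_fin circle_pow_ge0.
  - by apply/measurable_EFinP; exact: measurable_funS mw.
  - exact: measurable_funeM.
  - by move=> t _; exact: witness_pow_le.
rewrite ge0_integralZl_EFin ?powR_ge0//; last first.
  by move=> t _; apply: nneseries_ge0 => n _ _; rewrite lee_fin.
rewrite EFinM; apply: lee_wpmul2l; first by rewrite lee_fin powR_ge0.
rewrite integral_nneseries//; last by move=> n t _; rewrite lee_fin.
apply: (@le_trans _ _ (\sum_(n <oo) (decay n * (4 * pi))%:E)%E).
  apply: lee_nneseries => [n _ _|n _].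
    by apply: integral_ge0 => t _; rewrite lee_fin.
  rewrite (_ : (\int[_]_(_ in _) _)%E = seg_int 0 (2 * pi)
     (fun t => decay n * term_poisson r n t))// seg_intZ ?decay_ge0//; first last.
  - by move=> t; exact: poisson_ge0 (radius_lt1 n r01).
  - apply: continuous_measurable_fun.
    exact: continuous_poisson (radius_lt1 n r01).
  rewrite EFinM; apply: lee_wpmul2l; first by rewrite lee_fin decay_ge0.
  exact: poisson_integral (radius_lt1 n r01).
have pi40 : 0 <= 4 * pi :> R by rewrite mulr_ge0// pi_ge0.
apply: lime_le.
  by apply: is_cvg_nneseries => n _ _; rewrite lee_fin mulr_ge0 ?decay_ge0.
apply: nearW => n; rewrite sumEFin lee_fin -mulr_suml ler_wpM2r//.
apply: (nondecreasing_cvgn_le _ cvgn_decay n).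
by apply: nondecreasing_series => k _ _; exact: decay_ge0.
Qed.

End witness_means.

(** * Infinite means of the witness for larger exponents, on every arc *)

Section witness_blowup.
Context {R : realType}.
Variable P : R.
Hypothesis P2 : 2 <= P.
Implicit Types (n : nat) (q a b r t : R).

(** Pigeonhole: the codes of [(c, 0), ..., (c, N)] are distinct, so they cannot all be below [N]. *)
Lemma angle_infinitely_often (c : rat) (N : nat) :
  exists2 n, (N <= n)%N & angle n = ratr c :> R.
Proof.
have [j Nj] : exists j : nat, (N <= pickle (c, j))%N.
  apply/not_existsP => Nlt.
  have lt (j : 'I_N.+1) : (pickle (c, (j : nat)) < N)%N.
    by rewrite ltnNge; apply/negP/Nlt.
  have inj : injective (fun j => Ordinal (lt j)).
    by move=> i j [] /(pcan_inj pickleK)[] ij; exact: val_inj.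
  by have := leq_card _ inj; rewrite !card_ord ltnn.
by exists (pickle (c, j)) => //; rewrite /angle pickleK.
Qed.

(** By positivity a single term bounds the real part of the sum from below. On this circle and
    within angle [d] of its direction, its kernel has real part at least [d / (6 d^2)]. *)
Lemma witness_ge n t : `|t - angle n| <= pole_gap n ->
  0 < 1 - pole_gap n :> R ->
  amplitude P n / (6 * pole_gap n) <= normc (witness P (polar (1 - pole_gap n) t)).
Proof.
set d := pole_gap n => td d1; have d0 : 0 < d := pole_gap_gt0 n.
have r01 : 0 < 1 - d < 1 by rewrite d1 ltrBlDr ltrDl.
have z1 : normc (polar (1 - d) t) < 1 := polar_disc t r01.
apply: le_trans (normr_Re_le _); apply: le_trans (ler_norm _).
have := Re_cauchy_series_ge (@amplitude_ge0 R P) (cvgn_amplitude P2)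
  (@normc_pole_conj_lt1 R) n z1.
apply: le_trans; rewrite ler_wpM2l ?amplitude_ge0//.
rewrite Re_inv polarM sqr_normc_den Re_den -/d (addrC (- angle n)).
set phi := t - angle n in td *; set x := (1 - d) * (1 - d).
have x0 : 0 <= x by rewrite mulr_ge0 ?ltW.
have x1 : x < 1.
  by rewrite /x; have := d0; have := d1; nra.
have phi2 : phi ^+ 2 <= d ^+ 2.
  by rewrite -(real_normK (num_real phi)) lerXn2r ?nnegrE ?(ltW d0).
have c1 : 1 - d ^+ 2 <= cos phi by have := cos_ge1B_sqr phi; lra.
have N0 : 0 < sqdist x phi by apply: sqdist_gt0; rewrite x0 x1.
(* Here [(1 - x)^2] gives [4 d^2] and [2 x (1 - cos phi)] gives [2 d^2]. *)
have N6 : sqdist x phi <= 6 * d ^+ 2.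
  rewrite /sqdist; have : x * (1 - d ^+ 2) <= x * cos phi by rewrite ler_wpM2l.
  have : x * d ^+ 2 <= 1 * d ^+ 2 by rewrite ler_wpM2r ?sqr_ge0// ltW.
  have : (1 - x) ^+ 2 <= (2 * d) ^+ 2.
    rewrite lerXn2r ?nnegrE ?subr_ge0 ?(ltW x1) ?mulr_ge0 ?(ltW d0)//.
    by rewrite /x; have := sqr_ge0 d; rewrite expr2; lra.
  rewrite !expr2; lra.
have xc : d <= 1 - x * cos phi.
  have : x * cos phi <= x * 1 by rewrite ler_wpM2l// cos_le1.
  by rewrite /x; have := d1; have := d0; nra.
rewrite ler_pdivlMr// mulrC ler_pdivrMr ?mulr_gt0//.
apply: (le_trans N6).
have : d * (6 * d) <= (1 - x * cos phi) * (6 * d).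
  by rewrite ler_wpM2r// mulr_ge0// ltW.
rewrite expr2; lra.
Qed.

(** The left side bounds from below the [q]-integral over an arc of half-width [pole_gap n]. For
    [q > P] the quadratic exponent beats the linear loss [2 q n], so it tends to infinity. *)
Lemma blowup_scale q n :
  (amplitude P n / (6 * pole_gap n)) `^ q * (2 * pole_gap n) =
  2 * 6^-1 `^ q * expR (n%:R * (n%:R * (q / P - 1) - 2 * q)).
Proof.
have -> : amplitude P n / (6 * pole_gap n) = 6^-1 * expR (- (2 * n%:R) + n%:R ^+ 2 / P).
  have -> : expR (- (2 * n%:R) + n%:R ^+ 2 / P) = amplitude P n / pole_gap n.
    by rewrite /amplitude /pole_gap -expRN -expRD; congr expR; ring.
  by rewrite invfM mulrCA.
rewrite powRM ?expR_ge0// -expRM.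
have -> : expR (n%:R * (n%:R * (q / P - 1) - 2 * q)) =
    expR ((- (2 * n%:R) + n%:R ^+ 2 / P) * q) * pole_gap n.
  by rewrite /pole_gap -expRD; congr expR; ring.
by ring.
Qed.

Lemma sup_mean_witness_y q a b : P < q -> a < b ->
  sup_mean q a b (witness P) = +oo%E.
Proof.
move=> Pq ab; have P0 : 0 < P by rewrite (lt_le_trans _ P2).
have q0 : 0 < q := lt_trans P0 Pq.
apply/eqP; rewrite -leye_eq leNgt; apply/negP => /sup_mean_fin[B B0 wB].
have [c /[!in_itv]/= /andP[ac cb]] := rat_in_itvoo ab.
set c' : R := ratr c in ac cb.
pose m := Num.min (c' - a) (b - c').
have m0 : 0 < m by rewrite lt_min !subr_gt0 ac cb.
have s0 : 0 < q / P - 1 by rewrite subr_gt0 ltr_pdivlMr// mul1r.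
have k0 : 0 < 2 * 6^-1 `^ q :> R by rewrite mulr_gt0// powR_gt0.
(* For [n > N] the first summand gives [pole_gap n <= m], which keeps the arc in [[a, b]]; the
   second makes the exponent in [blowup_scale] at least [n]; the third makes the resulting bound
   exceed [B]. *)
pose N := m^-1 + (1 + 2 * q) / (q / P - 1) + B / (2 * 6^-1 `^ q).
have t1 : 0 <= m^-1 by rewrite invr_ge0 ltW.
have t2 : 0 <= (1 + 2 * q) / (q / P - 1).
  by rewrite divr_ge0 ?(ltW s0)// addr_ge0// mulr_ge0// ltW.
have t3 : 0 <= B / (2 * 6^-1 `^ q) by rewrite divr_ge0// ltW.
have [n Nn nc] := angle_infinitely_often c (Num.truncn N).+1.
have {Nn} Nn : N < n%:R.
  by apply: lt_le_trans (truncnS_gt N) _; rewrite ler_nat.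
have n1 : 1 <= n%:R :> R.
  by rewrite ler1n lt0n; apply: contraTneq Nn => ->; rewrite -leNgt !addr_ge0.
have gn : pole_gap n <= (1 + n%:R)^-1 :> R.
  rewrite /pole_gap expRN lef_pV2 ?posrE ?expR_gt0 ?ltr_wpDr//.
  apply: (le_trans (expR_ge1Dx _)); rewrite ler_expR expr2.
  by rewrite -[leLHS]mulr1 ler_wpM2l.
have gm : pole_gap n <= m.
  apply: (le_trans gn); rewrite -[leRHS]invrK lef_pV2 ?posrE ?invr_gt0 ?ltr_wpDr//.
  by move: Nn; rewrite /N; lra.
have g1 : 0 < 1 - pole_gap n :> R.
  have n2 : 0 < 1 + n%:R :> R by lra.
  by rewrite subr_gt0 (le_lt_trans gn)// invf_lt1//; lra.
have r01 : 0 < 1 - (pole_gap n : R) < 1 by rewrite g1 ltrBlDr ltrDl pole_gap_gt0.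
have mw := measurable_circle_pow q (holomorphic_witness P2) r01.
have mc : forall t, 0 <= circle_pow q (witness P) (1 - pole_gap n) t.
  by move=> t; exact: circle_pow_ge0.
have : ((2 * 6^-1 `^ q * expR (n%:R * (n%:R * (q / P - 1) - 2 * q)))%:E <= B%:E)%E.
  rewrite -wB; apply: le_trans (seg_int_le_sup_mean q a b (witness P) r01).
  have /andP[ma mb] : (m <= c' - a) && (m <= b - c') by rewrite -le_min.
  apply: (@le_trans _ _ (seg_int (c' - pole_gap n) (c' + pole_gap n)
      (circle_pow q (witness P) (1 - pole_gap n)%R))).
    rewrite -blowup_scale.
    have -> : 2 * pole_gap n = (c' + pole_gap n) - (c' - pole_gap n) :> R by ring.
    rewrite -seg_int_cst; last by have := pole_gap_gt0 n; lra.
    apply: le_seg_int => // [t|t /andP[tl tr]]; first exact: powR_ge0.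
    apply: ge0_ler_powR; rewrite ?nnegrE ?normc_ge0 ?(ltW q0)//.
      by rewrite divr_ge0 ?amplitude_ge0// mulr_ge0// ltW// pole_gap_gt0.
    by apply: witness_ge => //; rewrite nc ler_norml; apply/andP; split; lra.
  by apply: seg_int_sub => //; lra.
rewrite lee_fin leNgt => /negP; apply.
apply: (@lt_le_trans _ _ (2 * 6^-1 `^ q * n%:R)).
  rewrite -ltr_pdivrMl//; move: Nn; rewrite /N mulrC; lra.
rewrite ler_wpM2l ?(ltW k0)//.
apply: (@le_trans _ _ (expR n%:R)).
  by apply: le_trans (expR_ge1Dx _); rewrite lerDr.
rewrite ler_expR -[leLHS]mulr1 ler_wpM2l//.
have : (1 + 2 * q) / (q / P - 1) * (q / P - 1) <= n%:R * (q / P - 1).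
  by rewrite ler_wpM2r ?(ltW s0)//; move: Nn; rewrite /N; lra.
rewrite divfK ?gt_eqF//; lra.
Qed.

End witness_blowup.

(** * Genericity *)

Section singular_hardy.
Context {R : realType}.
Implicit Types (f g h : R[i] -> R[i]) (p q a b : R).

Definition nowhere_better p f := forall q a b, p < q -> a < b ->
  ~ (sup_mean q a b f < +oo)%E.

Lemma sup_meanX p a b f n :
  sup_mean p a b (fun z => f z ^+ n) = sup_mean (n%:R * p) a b f.
Proof.
rewrite /sup_mean; congr ereal_sup; apply: eq_imagel => r _.
apply: eq_integral => t _; congr EFin.
by rewrite normcX -powR_mulrn ?normc_ge0// powRrM.
Qed.

(* Raising to a power reduces the case of small p to exponents at least 2. *)
Lemma exists_nowhere_better p : 0 < p ->
  exists2 h, hardy_space p h & nowhere_better p h.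
Proof.
move=> p0; pose n := (Num.truncn (2 / p)).+1; pose P := n%:R * p.
have P2 : 2 <= P by rewrite /P -ler_pdivrMr// ltW// truncnS_gt.
exists (fun z => witness P z ^+ n).
  split; first exact/holomorphicX/holomorphic_witness.
  by rewrite sup_meanX; exact: sup_mean_witness_lty.
move=> q a b pq ab; rewrite sup_meanX sup_mean_witness_y//.
by rewrite /P ltr_pM2l// ltr0n.
Qed.

Lemma hardy_spaceD p f g : 0 < p -> hardy_space p f -> hardy_space p g ->
  hardy_space p (fun z => f z + g z).
Proof.
move=> p0 [hf fp] [hg gp]; split; first exact: holomorphicD.
exact: sup_meanD_lty.
Qed.

Lemma sup_meanZ_lty p a b f (c : R[i]) : 0 < p -> holomorphic_disc f ->
  (sup_mean p a b f < +oo)%E -> (sup_mean p a b (fun z => c * f z)%R < +oo)%E.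
Proof.
move=> p0 hf /sup_mean_fin[A A0 fA].
by rewrite (le_lt_trans (sup_meanZ_le a b c p0 hf))// fA -EFinM ltry.
Qed.

Lemma hardy_spaceZ p f (c : R[i]) : 0 < p -> hardy_space p f ->
  hardy_space p (fun z => c * f z).
Proof.
move=> p0 [hf fp]; split; first exact: holomorphicZ.
exact: sup_meanZ_lty.
Qed.

(** Otherwise [h = ((f + c h) - (f + d h)) / (c - d)] would have a finite mean too. *)
Lemma local_perturbation_uniq q a b f h (c d : R) : 0 < q ->
  holomorphic_disc f -> holomorphic_disc h -> ~ (sup_mean q a b h < +oo)%E ->
  (sup_mean q a b (fun z => f z + c%:C * h z)%R < +oo)%E ->
  (sup_mean q a b (fun z => f z + d%:C * h z)%R < +oo)%E -> c = d.
Proof.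
move=> q0 hf hh hN fc fd; apply: contrapT => /eqP cd; apply: hN.
have hfk k := holomorphicD hf (holomorphicZ k%:C hh).
have cd0 : (c - d)%:C != 0 :> R[i] by rewrite eq_complex /= eqxx andbT subr_eq0.
have := sup_meanD_lty q0 (holomorphicZ (c - d)%:C^-1 (hfk c))
  (holomorphicZ (- (c - d)%:C^-1) (hfk d)) (sup_meanZ_lty _ q0 (hfk c) fc)
  (sup_meanZ_lty _ q0 (hfk d) fd).
congr (sup_mean q a b _ < +oo)%E; apply/funext => z.
have cdE : (c - d)%:C = c%:C - d%:C :> R[i] by exact: rmorphB.
by rewrite cdE; rewrite cdE in cd0; field.
Qed.

Lemma rat_subinterval a b : a < b ->
  exists x y : rat, [/\ a < ratr x, (ratr x : R) < ratr y & ratr y < b].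
Proof.
move=> ab; have [x /[!in_itv]/= /andP[ax xb]] := rat_in_itvoo ab.
have [y /[!in_itv]/= /andP[xy yb]] := rat_in_itvoo xb.
by exists x, y.
Qed.

Lemma exists_invS_le p q : p < q -> exists m : nat, p + m.+1%:R^-1 <= q.
Proof.
move=> pq; exists (Num.truncn (q - p)^-1).
have qp : 0 < q - p by rewrite subr_gt0.
rewrite -lerBrDl -[leRHS]invrK lef_pV2 ?posrE ?invr_gt0//.
exact/ltW/truncnS_gt.
Qed.

Lemma ltr_addinvS p m : p < p + m.+1%:R^-1.
Proof. by rewrite ltrDl invr_gt0. Qed.

Lemma hardy_perturbation p f h (e : R) : 0 < p -> 0 < e ->
  hardy_space p f -> hardy_space p h -> nowhere_better p h ->
  exists g, [/\ hardy_space p g, (hardy_gap p g f < e%:E)%E & nowhere_better p g].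
Proof.
move=> p0 e0 fp hp hN; have [hf _] := fp; have [hh /sup_mean_fin[A A0 hA]] := hp.
have A1 : 0 < A + 1 by rewrite ltr_wpDl.
(* Solves [d^p (A + 1) = e], where [A] is the mean of [h]; the added 1 keeps the divisor
   positive. *)
pose d := (e / (A + 1)) `^ p^-1.
have d0 : 0 < d by apply: powR_gt0; exact: divr_gt0.
pose g (c : R) z := f z + c%:C * h z.
have hg c : holomorphic_disc (g c) := holomorphicD hf (holomorphicZ _ hh).
pose ex (m : nat) : R := p + m.+1%:R^-1.
(* Scalars spoiling one exponent and one rational arc; each such set has at most one element. *)
pose bad (i : nat * rat * rat) := [set c : R | (ratr i.1.2 : R) < ratr i.2 /\
  (sup_mean (ex i.1.1) (ratr i.1.2) (ratr i.2) (g c) < +oo)%E].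
have [c /andP[c0 cd] cgood] : exists2 c, 0 < c < d & forall i, ~ bad i c.
  apply: contrapT => noc.
  have sub : `]0, d[%classic `<=` \bigcup_i bad i.
    move=> c; rewrite /= in_itv/= => c0d; apply: contrapT => cb.
    by apply: noc; exists c => // i ci; apply: cb; exists i.
  have cbad : countable (\bigcup_i bad i).
    apply: bigcup_countable => // i _; apply: finite_set_countable.
    have [[c ci]|/forallNP bi] := pselect (exists c, bad i c); last first.
      by rewrite (_ : bad i = set0) // -subset0 => c /bi.
    apply: (@sub_finite_set _ _ [set c]) => // c' ci'; apply/esym.
    move: ci ci' => [xy cfin] [_ cfin'].
    apply: (local_perturbation_uniq _ hf hh _ cfin cfin').
      by rewrite addr_gt0.
    by apply: hN => //; exact: ltr_addinvS.
  (* A countable set is Lebesgue null, whereas []0, d[] has measure [d > 0]. *)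
  have := countable_lebesgue_measure0 (sub_countable (subset_card_le sub) cbad).
  rewrite lebesgue_measure_itv/= lte_fin d0 -EFinB subr0 => -[] d_0.
  by move: d0; rewrite d_0 ltxx.
exists (g c); split.
- exact: hardy_spaceD (hardy_spaceZ _ _ _).
- rewrite /hardy_gap (_ : (fun z => g c z - f z) = (fun z => c%:C * h z)); last first.
    by apply/funext => z; rewrite /g addrC addKr.
  apply: (le_lt_trans (sup_meanZ_le _ _ _ p0 hh)).
  rewrite hA normc_real gtr0_norm// -EFinM lte_fin.
  have cpd : c `^ p < e / (A + 1).
    have -> : e / (A + 1) = d `^ p.
      by rewrite /d -powRrM mulVf ?gt_eqF// powRr1// ltW// divr_gt0.
    by rewrite gt0_ltr_powR ?nnegrE ?(ltW c0) ?(ltW d0).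
  apply: (@le_lt_trans _ _ (c `^ p * (A + 1))).
    by rewrite ler_wpM2l ?powR_ge0// lerDl.
  by rewrite -ltr_pdivlMr.
- move=> q a b pq ab gq.
  (* A finite mean for [q] on [[a, b]] would give one for some [p + 1/(m+1) <= q] on a rational arc
     inside. *)
  have [m mq] := exists_invS_le pq; have [x [y [ax xy yb]]] := rat_subinterval ab.
  have gm : (sup_mean (ex m) (ratr x) (ratr y) (g c) < +oo)%E.
    apply: (sup_mean_lty_sub _ mq (ltW ax) (ltW yb) (hg c) gq).
    by rewrite addr_gt0.
  exact: (cgood (m, x, y) (conj xy gm)).
Qed.

End singular_hardy.

(** * The generic set in the topology of [H^p] *)

Lemma hardyP (R : realType) (p : R) (f : hardy p) : hardy_space p f.
Proof. exact: set_mem (valP f). Qed.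

(** A supremum above [M] exceeds [M] at one radius already, and lower semicontinuity there gives a
    ball. *)
Lemma open_sup_mean_gt (R : realType) (p q a b M : R) : 0 < p -> p < q -> 0 <= M ->
  open [set f : hardy p | (M%:E < sup_mean q a b f)%E].
Proof.
move=> p0 pq M0; rewrite -[open _]/(hardy_open _) => f /=.
move=> /ereal_sup_gt[_ [r /= + <-]]; rewrite in_itv => r01 Mf.
have [hf _] := hardyP f.
have [e e0 fe] := seg_int_circle_pow_lsc p0 pq M0 r01 hf Mf.
exists e => // g gf; have [hg _] := hardyP g.
exact: lt_le_trans (fe g hg gf) (seg_int_le_sup_mean q a b g r01).
Qed.

Lemma nowhere_better_Gdelta (R : realType) (p : R) : 0 < p ->
  Gdelta [set f : hardy p | nowhere_better p f].
Proof.
move=> p0.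
(* An index holds an exponent, two rational endpoints and an integer threshold; endpoints in the
   wrong order give the whole space. *)
pose U (i : nat * rat * rat * nat) : set (hardy p) :=
  [set f | (ratr i.1.1.2 : R) < ratr i.1.2 ->
    (i.2%:R%:E < sup_mean (p + i.1.1.1.+1%:R^-1) (ratr i.1.1.2) (ratr i.1.2) f)%E].
have oU i : open (U i).
  have [xy|xy] := ltP (ratr i.1.1.2 : R) (ratr i.1.2); last first.
    rewrite (_ : U i = setT); first exact: openT.
    by apply/seteqP; split => // f _; rewrite /U/= ltNge xy.
  rewrite (_ : U i = [set f : hardy p | (i.2%:R%:E <
      sup_mean (p + i.1.1.1.+1%:R^-1) (ratr i.1.1.2) (ratr i.1.2) f)%E]).
    by apply: open_sup_mean_gt => //; exact: ltr_addinvS.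
  by apply/seteqP; split => f /=; [exact|move=> ? _].
(* Integers that code no index contribute the whole space. *)
exists (fun k => if unpickle k is Some i then U i else setT).
  by move=> k; case: unpickle => [i|]; [exact: oU|exact: openT].
apply/seteqP; split => f /= fS.
  move=> k _; case: unpickle => [i|//] xy; apply: contrapT => /negP.
  rewrite -leNgt => fi; apply: (fS _ _ _ (ltr_addinvS p i.1.1.1) xy).
  by rewrite (le_lt_trans fi)// ltry.
move=> q a b pq ab fq; have [hf _] := hardyP f.
have [m mq] := exists_invS_le pq; have [x [y [ax xy yb]]] := rat_subinterval ab.
have /sup_mean_fin[B B0 fB] :
    (sup_mean (p + m.+1%:R^-1) (ratr x) (ratr y) f < +oo)%E.
  apply: (sup_mean_lty_sub _ mq (ltW ax) (ltW yb) hf fq).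
  by rewrite addr_gt0.
have := fS (pickle (m, x, y, (Num.truncn B).+1)) I; rewrite pickleK.
move=> /(_ xy) /=; rewrite fB lte_fin => /ltW.
by rewrite leNgt truncnS_gt.
Qed.

Lemma nowhere_better_dense (R : realType) (p : R) : 0 < p ->
  dense [set f : hardy p | nowhere_better p f].
Proof.
move=> p0 U [f Uf] oU; have {}oU : hardy_open U := oU.
have [e e0 eU] := oU f Uf; have [h hp hN] := exists_nowhere_better p0.
have [g [gp gf gN]] := hardy_perturbation p0 e0 (hardyP f) hp hN.
by exists (Hardy (mem_set gp)); split => //; exact: eU.
Qed.

Theorem theorem8 (R : realType) (p : R) (p_gt0 : 0 < p) :
  let S :=
    [set f : hardy p | forall q a b : R, p < q -> a < b -> ~ local_hardy_space q a b f] in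
  [/\ S = [set f : hardy p | forall q a b : R, p < q -> a < b ->
                     sup_mean q a b f = +oo%E],
      Gdelta S, dense S & S !=set0].
Proof.
move=> S.
(* Members of [H^p] are holomorphic, so lying outside the local space means exactly having an
   infinite mean. *)
have SE : S = [set f : hardy p | nowhere_better p f].
  apply/seteqP; split => f fS q a b pq ab.
    by move=> fq; apply: (fS q a b pq ab); split => //; case: (hardyP f).
  by move=> [_]; exact: fS.
split.
- rewrite SE; apply/seteqP; split => f fS q a b pq ab.
    by apply/eqP; rewrite -leye_eq leNgt; apply/negP/fS.
  by rewrite (fS q a b pq ab).
- by rewrite SE; exact: nowhere_better_Gdelta.
- by rewrite SE; exact: nowhere_better_dense.
- have [h hp hN] := exists_nowhere_better p_gt0.
  by exists (Hardy (mem_set hp)); rewrite SE.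
Qed.
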